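(* Let $p\ge 1$ be an integer, let $\omega>0$, $\alpha\ge 0$ and $k\ge 0$ be constants, and let $(\eta_t)_{t\in\mathbb{Z}}$ be an i.i.d. sequence of real random variables such that $E\eta_t=0$, $E\eta_t^2=1$, and $\eta_t^2$ admits a density $f$ with respect to the Lebesgue measure on $\mathbb{R}^+=[0,\infty)$ with $f>0$ on $\mathbb{R}^+$. Write $\mu_{2s}=E(\eta_t^{2s})\in(0,\infty]$ for integers $s\ge 1$ and assume $\mu_{2p}<\infty$. If $$0\le\alpha<\max_{m\in\{1,2,\ldots\}}\left(\frac{k^{m-1}}{\mu_{2p}\,\mu_{2m}^{1-1/m}\,\mu_{2mp}^{1/m}}\right)^{1/(2p+m-1)},$$ then there exists a strictly stationary solution process $(\varepsilon_t)$ to the model $$\varepsilon_t=\sigma_t\eta_t,\qquad \sigma_t^2=\omega+\alpha\,\varepsilon_{t-1}^2\,\mathbb{1}_{\varepsilon_{t-1}^2>k\varepsilon_{t-2}^2},\qquad \sigma_t>0,$$ such that, under the stationary distribution, $E(\varepsilon_t^{2p})<\infty$.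
   Context: A solution of the model is a process $(\varepsilon_t)$, defined together with an i.i.d. sequence $(\eta_t)$ of the prescribed law on some probability space, which satisfies the displayed equations almost surely for every $t$, where $\eta_t$ is independent of the past $\{\varepsilon_s : s<t\}$ (so that $\sigma_t$, a measurable function of the past, is independent of $\eta_t$). Conventions in the moment condition: $k^{0}=1$ also when $k=0$, and a term of the maximum in which $\mu_{2m}$ or $\mu_{2mp}$ is infinite is taken to be $0$. *)

(* Defs.v *)
From HB Require Import structures.
From mathcomp Require Import all_boot all_order all_algebra.
From mathcomp Require Import all_classical all_reals all_analysis.

Set Implicit Arguments.
Unset Strict Implicit.
Unset Printing Implicit Defensive.

Import Order.TTheory GRing.Theory Num.Theory.
Import numFieldNormedType.Exports.

Local Open Scope classical_set_scope.
Local Open Scope ring_scope.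

Section law.
Context {R : realType}.
Implicit Types (nu : probability (measurableTypeR R) R) (f : R -> R).

Definition square_density nu f : Prop :=
  measurable_fun `[(0 : R), +oo[ f /\
  forall A : set R, measurable A ->
    nu ((fun x => x ^+ 2) @^-1` A) =
    (\int[lebesgue_measure]_(y in A `&` `[0%R, +oo[) (f y)%:E)%E.

(* [moment nu s] is the moment of order 2s. *)
Definition moment nu (s : nat) : \bar R := ('E_nu[fun x => (x ^+ (2 * s))%R])%E.

Definition moment_term nu (p : nat) (k : R) (m : nat) : R :=
  if (moment nu m < +oo)%E && (moment nu (m * p) < +oo)%E then
    (k ^+ (m - 1) /
       (fine (moment nu p) * fine (moment nu m) `^ (1 - m%:R^-1) *
        fine (moment nu (m * p)) `^ (m%:R^-1)))
    `^ (2 * p + m - 1)%:R^-1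
  else 0.

(* When the square of the variable has a positive density on the half line, the
   terms are bounded and tend to 0 as m grows, so that this supremum is a
   maximum. *)
Definition moment_threshold nu (p : nat) (k : R) : \bar R :=
  ereal_sup [set (moment_term nu p k m)%:E | m in [set m : nat | (1 <= m)%N]].

End law.

Section process.
Context {d : measure_display} {T : measurableType d} {R : realType}.
Variable P : probability T R.
Implicit Types X eps eta : int -> {RV P >-> R}.

Definition mutually_independent X : Prop :=
  forall (s : seq int) (B : int -> set R), uniq s ->
    (forall i, measurable (B i)) ->
    P (\bigcap_(i in [set` s]) (X i @^-1` B i)) =
    (\prod_(i <- s) P (X i @^-1` B i))%E.

Definition has_law (nu : probability (measurableTypeR R) R)
    (Y : {RV P >-> R}) : Prop :=
  forall B : set R, measurable B -> distribution P Y B = nu B.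

Definition sigma_past X (t : int) : set (set T) :=
  <<s \bigcup_(s in [set s : int | s < t])
        preimage_set_system setT (X s) measurable >>.

Definition independent_of_past X (t : int) (Y : {RV P >-> R}) : Prop :=
  forall (A : set T) (B : set R), sigma_past X t A -> measurable B ->
    P (A `&` Y @^-1` B) = (P A * P (Y @^-1` B))%E.

Definition strictly_stationary X : Prop :=
  forall (n : nat) (t : 'I_n -> int) (h : int)
    (B : set (n.-tuple (measurableTypeR R))), measurable B ->
    P [set w | B [tuple X (t i + h) w | i < n]] =
    P [set w | B [tuple X (t i) w | i < n]].

Definition is_solution (omega alpha k : R)
    (nu : probability (measurableTypeR R) R) eta eps : Prop :=
  [/\ mutually_independent eta,
      forall t, has_law nu (eta t),
      forall t, independent_of_past eps t (eta t) &
      exists sigma : int -> {RV P >-> R}, forall t,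
        {ae P, forall w,
          [/\ eps t w = sigma t w * eta t w,
              sigma t w ^+ 2 = omega + alpha * eps (t - 1) w ^+ 2 *
                (k * eps (t - 2) w ^+ 2 < eps (t - 1) w ^+ 2)%R%:R &
              0 < sigma t w]}].

End process.

(* Main.v *)
(* Put y_t = eps_t^2 and v_t = sigma_t^2.  The pair (y_t, v_(t+1)) is a Markov
   chain driven by eta_t, and the stationary solution is obtained by running it
   from the fixed state (0, omega) at time t - n and letting n go to infinity.

   Since the indicator of y_t > k y_(t-1) is at most (y_t / (k y_(t-1)))^(m-1),
   one has, up to bounded terms,
     E[v_(t+2)^p | past] <= alpha^(2p+m-1) k^(1-m) mu_(2(p+m-1)) y_t^p,
   and mu_(2(p+m-1)) <= mu_(2m)^(1-1/m) mu_(2mp)^(1/m) by Hoelder.  Under the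
   moment condition y^p + lam v^p is therefore a Lyapunov function for a suitable
   lam, which bounds E(y_t^p) uniformly in n.

   If k > 0, two copies of the chain driven by the same noise coalesce with
   positive probability within three steps from any bounded set: first y gets
   bounded below, then a small innovation makes both indicators 0, so that both
   v equal omega, and finally a large innovation makes both indicators 1, so that
   both states depend on this innovation only.  The positive density of eta^2
   gives these three events positive probability.  Together with the Lyapunov
   function this yields a contraction for the coupled chain; hence the n-step and
   (n+1)-step approximations differ with probability O(r^n), and by Borel-Cantelli
   they are eventually constant in n almost surely.  If k = 0 the indicator is
   irrelevant and the approximations are nondecreasing in n. *)
From HB Require Import structures.
Require Import Defs.
From mathcomp Require Import all_boot all_order all_algebra.
From mathcomp Require Import all_classical all_reals all_analysis.
From mathcomp Require Import measurable_realfun ring lra zify.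

Set Implicit Arguments.
Unset Strict Implicit.
Unset Printing Implicit Defensive.

Import Order.TTheory GRing.Theory Num.Theory.
Import numFieldNormedType.Exports.

Local Open Scope classical_set_scope.
Local Open Scope ring_scope.

(** * Product sigma-algebras and i.i.d. families *)

(** The family [B] is total but only the finitely many indices in [s] constrain, so two cylinders
    intersect by concatenating their lists. The list may repeat an index. *)
Definition cylinders (I : eqType) d (E : measurableType d) :
    set (set (I -> E)) :=
  [set C | exists (s : seq I) (B : I -> set E), (forall i, measurable (B i)) /\
     C = [set x | forall i, i \in s -> B i (x i)]].
Arguments cylinders I {d} E.

Definition seqspace (I : eqType) d (E : measurableType d) :=
  g_sigma_algebraType (cylinders I E).

HB.instance Definition _ (I : eqType) d (E : measurableType d) :=
  Measurable.on (seqspace I E).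

Section seqspace_theory.
Context {I : eqType} {d : measure_display} {E : measurableType d}.

Lemma cylinders_measurable (C : set (seqspace I E)) :
  cylinders I E C -> measurable C.
Proof. exact: sub_sigma_algebra. Qed.

Lemma cylinders_setI : setI_closed (cylinders I E).
Proof.
move=> _ _ [s [B [mB ->]]] [s' [B' [mB' ->]]].
exists (s ++ s').
exists (fun i => (if i \in s then B i else setT) `&`
                 (if i \in s' then B' i else setT)).
split=> [i|]; first by apply: measurableI; case: ifP.
apply/seteqP; split=> [x /= [h h'] i _|x /= h].
  by split; case: ifP => // ?; [exact: h|exact: h'].
by split=> i is_; have := h i; rewrite mem_cat is_ ?orbT => /(_ isT) [].
Qed.

Lemma cylinders_setT : cylinders I E setT.
Proof. by exists [::], (fun=> setT); split=> //; apply/seteqP; split. Qed.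

Lemma measurable_coord (i : I) :
  measurable_fun setT (fun x : seqspace I E => x i).
Proof.
move=> _ B mB; rewrite setTI; apply: cylinders_measurable.
exists [:: i], (fun=> B); split => //.
apply/seteqP; split=> x /=; last by apply; rewrite inE.
by move=> Bx j; rewrite inE => /eqP->.
Qed.

Lemma measurable_seqspaceP d' (T : measurableType d') (f : T -> seqspace I E) :
  (forall i, measurable_fun setT (fun w => f w i)) -> measurable_fun setT f.
Proof.
move=> mf; apply: (@measurability _ _ _ _ setT f (cylinders I E)) => //.
move=> _ [_ [s [B [mB ->]]] <-]; rewrite setTI.
rewrite (_ : _ @^-1` _ = \bigcap_(i in [set` s]) ((fun w => f w i) @^-1` B i)).
  by apply: fin_bigcap_measurable => // i _; rewrite -[X in measurable X]setTI;
    exact: mf.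
by apply/seteqP; split=> w /= h i /=; exact: h.
Qed.

End seqspace_theory.

(** For fixed [F] the sets that satisfy the factorization form a Dynkin class, so a generating
    pi-system suffices. [Q] is a prescribed law: with [F] the whole space the lemma also identifies
    the law of [U]. *)
Lemma factor_pi_ext (R : realType) d d' (T : measurableType d)
    (S : measurableType d') (P : probability T R) (Q : probability S R)
    (U : T -> S) (G : set (set S)) (F : set T) :
  measurable_fun setT U -> measurable = <<s G >> -> setI_closed G ->
  measurable F ->
  (forall A, G A -> P (F `&` U @^-1` A) = (P F * Q A)%E) ->
  forall A, measurable A -> P (F `&` U @^-1` A) = (P F * Q A)%E.
Proof.
move=> mU mG GI mF FG.
have mUA A : measurable A -> measurable (U @^-1` A).
  by move=> mA; rewrite -[X in measurable X]setTI; exact: mU.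
move=> A mA; have {mA} : <<s G >> A by rewrite -mG.
apply: (@dynkin_induction _ S G (fun A =>
  P (F `&` U @^-1` A) = (P F * Q A)%E) mG GI) => // {A}.
- by rewrite preimage_setT setIT probability_setT mule1.
- move=> A mA FA.
  have -> : U @^-1` (~` A) = ~` (U @^-1` A) by [].
  transitivity (P F - P F * Q A)%E.
    rewrite -FA -setDE; apply: measureD => //; first exact: mUA.
    by rewrite (le_lt_trans (probability_le1 _ _)) ?ltry.
  rewrite (probability_setC _ mA).
  by rewrite muleBr ?mule1// ?fin_num_measure// fin_num_adde_defr.
- move=> A mA tA FA.
  have tUA : trivIset setT (fun n => U @^-1` A n).
    apply/trivIsetP => i j _ _ ij; rewrite -preimage_setI.
    by move/trivIsetP : tA => /(_ _ _ _ _ ij) ->//; rewrite preimage_set0.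
  rewrite preimage_bigcup setI_bigcupr measure_bigcup//=; last 2 first.
  + by move=> i _; apply: measurableI => //; exact: mUA.
  + exact: trivIset_setIl.
  rewrite measure_bigcup//=.
  rewrite -[P F]fineK ?fin_num_measure// -nneseriesZl//.
  by apply: eq_eseriesr => i _; rewrite fineK ?fin_num_measure//; exact: FA.
Qed.

(** Independence and common law in one formula: lists of length one give the law. A repeated index
    would count its factor twice, whence [uniq s]. *)
Definition iid_family (R : realType) (I : eqType) d d' (T : measurableType d)
    (E : measurableType d') (P : set T -> \bar R) (nu : set E -> \bar R)
    (X : I -> T -> E) :=
  forall (s : seq I) (B : I -> set E), uniq s -> (forall i, measurable (B i)) ->
    P [set w | forall i, i \in s -> B i (X i w)] = (\prod_(i <- s) nu (B i))%E.

Section iid_theory.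
Context {R : realType} {I : eqType} {d : measure_display} {E : measurableType d}.
Variables (nu : probability E R).

(** The formula fixes both measures on the cylinders, a pi-system that generates the
    sigma-algebra. *)
Lemma iid_family_unique (P Q : probability (seqspace I E) R) :
  iid_family P nu (fun i x => x i) -> iid_family Q nu (fun i x => x i) ->
  forall A, measurable A -> P A = Q A.
Proof.
move=> hP hQ.
apply: (@measure_unique _ R (seqspace I E) (cylinders I E) (fun=> setT) erefl
  (@cylinders_setI _ _ _) _ _ P Q).
- by move=> _; exact: cylinders_setT.
- by rewrite bigcup_const//; exists 0%N.
- move=> _ [s [B [mB ->]]].
  have E1 : [set x : I -> E | forall i, i \in s -> B i (x i)] =
      [set x | forall i, i \in undup s -> B i (x i)].
    by apply/seteqP; split=> x /= h i; have := h i; rewrite mem_undup.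
  rewrite E1.
  exact: etrans (hP _ _ (undup_uniq s) mB) (esym (hQ _ _ (undup_uniq s) mB)).
- by move=> _; exact: (le_lt_trans (probability_le1 P measurableT) (ltry 1)).
Qed.

(** Freezing the coordinates outside [J] stays within the same space; a set depends on the
    coordinates in [J] only when it equals its preimage under this map. *)
Definition restrict_coords (J : pred I) (x : seqspace I E) : seqspace I E :=
  fun i => if J i then x i else point.

Lemma measurable_restrict_coords (J : pred I) :
  measurable_fun setT (restrict_coords J).
Proof.
apply: measurable_seqspaceP => i; rewrite /restrict_coords.
by case: (J i) => //; exact: measurable_coord.
Qed.

Let restrict_coords_mfun (J : pred I) :=
  isMeasurableFun.Build _ _ _ _ _ (measurable_restrict_coords J).

(** Two uses of [factor_pi_ext] reduce both sets to cylinders over a common index list. There each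
    coordinate constrains at most one of the two sets, and the product formula splits factor by
    factor. *)
Lemma iid_indep_restrict (P : probability (seqspace I E) R) (J : pred I) :
  iid_family P nu (fun i x => x i) ->
  forall A C, measurable A -> measurable C ->
  P (restrict_coords J @^-1` A `&` restrict_coords (predC J) @^-1` C) =
  (P (restrict_coords J @^-1` A) * P (restrict_coords (predC J) @^-1` C))%E.
Proof.
move=> hP A C mA mC.
have mr K D : measurable D -> measurable (restrict_coords K @^-1` D).
  by move=> mD; rewrite -[X in measurable X]setTI; exact: measurable_restrict_coords.
pose rJ : {RV P >-> seqspace I E} :=
  HB.pack (restrict_coords J) (restrict_coords_mfun J).
pose rJ' : {RV P >-> seqspace I E} :=
  HB.pack (restrict_coords (predC J)) (restrict_coords_mfun (predC J)).
apply: (@factor_pi_ext R _ _ (seqspace I E) (seqspace I E) P (distribution P rJ')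
  (restrict_coords (predC J)) (cylinders I E) (restrict_coords J @^-1` A) _ erefl
  (@cylinders_setI _ _ _) _ _ C mC).
- exact: measurable_restrict_coords.
- exact: mr.
move=> {C mC}C cC; have mC := cylinders_measurable cC.
transitivity (P (rJ' @^-1` C) * P (rJ @^-1` A))%E; last exact: muleC.
rewrite setIC.
apply: (@factor_pi_ext R _ _ (seqspace I E) (seqspace I E) P (distribution P rJ)
  (restrict_coords J) (cylinders I E) (restrict_coords (predC J) @^-1` C) _ erefl
  (@cylinders_setI _ _ _) _ _ A mA).
- exact: measurable_restrict_coords.
- exact: mr.
move=> {A mA}A cA.
transitivity (P (rJ' @^-1` C) * P (rJ @^-1` A))%E => //.
rewrite /rJ /rJ' /=.
case: cC => s [B [mB ->]]; case: cA => s' [B' [mB' ->]].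
pose u := undup (s ++ s').
(* On a frozen coordinate the constraint only tests [point], so [ext] is there the whole space or
   empty. *)
pose ext (K : pred I) (v : seq I) (D : I -> set E) i : set E :=
  if i \in v then [set e | D i (if K i then e else point)] else setT.
have mext K v D : (forall i, measurable (D i)) -> forall i, measurable (ext K v D i).
  move=> mD i; rewrite /ext; case: ifP => // _; case: (K i) => //.
    exact: mD.
  have [h|h] := pselect (D i point).
    by rewrite (_ : [set _ | _] = setT)//; apply/seteqP; split.
  by rewrite (_ : [set _ | _] = set0)//; apply/seteqP; split.
have extE K v D : {subset v <= u} ->
    restrict_coords K @^-1` [set x | forall i, i \in v -> D i (x i)] =
    [set x | forall i, i \in u -> ext K v D i (x i)].
  move=> vu; apply/seteqP; split=> x /= h i iv; last first.
    by have := h _ (vu _ iv); rewrite /ext iv.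
  by rewrite /ext; case: ifP => // iv'; exact: h.
have su : {subset s <= u} by move=> i is_; rewrite mem_undup mem_cat is_.
have su' : {subset s' <= u} by move=> i is_; rewrite mem_undup mem_cat is_ orbT.
rewrite !extE//.
rewrite (_ : _ `&` _ = [set x | forall i, i \in u ->
    (ext (predC J) s B i `&` ext J s' B' i) (x i)]); last first.
  apply/seteqP; split=> x /=.
    by move=> [h h'] i iu; split; [exact: h|exact: h'].
  by move=> h; split=> i iu; have [] := h i iu.
have mB1 := mext (predC J) s B mB; have mB2 := mext J s' B' mB'.
have mB12 i : measurable (ext (predC J) s B i `&` ext J s' B' i).
  exact: measurableI.
rewrite !hP ?undup_uniq//.
rewrite -big_split/=.
apply: etrans (hP _ (fun i => ext (predC J) s B i `&` ext J s' B' i) (undup_uniq _) mB12) _.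
apply: eq_bigr => i _.
have triv K v D : ~~ K i -> ext K v D i = setT \/ ext K v D i = set0.
  move=> /negbTE Ki; rewrite /ext Ki; case: ifP => _; last by left.
  have [h|h] := pselect (D i point); [left|right]; by apply/seteqP; split.
have [Ji|nJi] := boolP (J i).
- have [|->|->] := triv (predC J) s B; first by rewrite /= Ji.
  + by rewrite setTI probability_setT mul1e.
  + by rewrite set0I measure0 mul0e.
- have [->|->] := triv J s' B' nJi.
  + by rewrite setIT probability_setT mule1.
  + by rewrite setI0 measure0 mule0.
Qed.

End iid_theory.

(** * Construction of i.i.d. sequences *)

Section uniform_distribution.
Context {R : realType}.

Definition rays : set (set R) := [set A | exists x, A = `]-oo, x]%classic].

Lemma measurable_rays : @measurable _ (measurableTypeR R) = <<s rays >>.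
Proof.
rewrite -[LHS]/((@ocitv R).-sigma.-measurable).
rewrite RGenOInfty.measurableE; apply/seteqP; split.
  apply: smallest_sub; first exact: smallest_sigma_algebra.
  move=> _ [x ->]; rewrite -setCitvl; apply: sigma_algebraC.
  by apply: sub_sigma_algebra; exists x.
apply: smallest_sub; first exact: smallest_sigma_algebra.
move=> _ [x ->]; rewrite -setCitvr; apply: sigma_algebraC.
by apply: sub_sigma_algebra; exists x.
Qed.

Lemma rays_setI : setI_closed rays.
Proof.
move=> _ _ [x ->] [y ->]; exists (Num.min x y); apply/seteqP; split=> z /=;
  by rewrite !in_itv/= le_min => /andP.
Qed.

Lemma rays_unique (P Q : {measure set (measurableTypeR R) -> \bar R}) :
  (P setT < +oo)%E ->
  (forall x, P `]-oo, x]%classic = Q `]-oo, x]%classic) ->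
  forall A, measurable A -> P A = Q A.
Proof.
move=> Poo PQ.
apply: (@measure_unique _ R (measurableTypeR R) rays
  (fun n => `]-oo, n%:R]%classic) measurable_rays rays_setI) => //.
- by move=> n; exists n%:R.
- rewrite -subTset => x _; exists (Num.trunc x).+1 => //=.
  by rewrite in_itv/= ltW// truncnS_gt.
- by move=> _ [x ->].
- move=> n; apply: le_lt_trans Poo; apply: le_measure => //; rewrite inE//.
Qed.

Definition unif : probability (measurableTypeR R) R := uniform_prob (@ltr01 R).

Lemma unifE (A : set R) : measurable A ->
  unif A = lebesgue_measure (A `&` `[0%R, 1%R]%classic).
Proof.
move=> mA.
rewrite -[LHS]/(\int[lebesgue_measure]_(x in A) (uniform_pdf 0 1 x)%:E)%E.
rewrite integral_uniform_pdf.
rewrite (eq_integral (fun=> 1%E)); last first.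
  move=> x; rewrite inE/= in_itv/= => -[_ x01].
  by rewrite /uniform_pdf x01 subr0 invr1.
by rewrite integral_cst/= ?mul1e//; exact: measurableI.
Qed.

Lemma unif_ray (x : R) :
  unif `]-oo, x]%classic = (Num.max 0 (Num.min x 1))%:E.
Proof.
rewrite unifE//.
have -> : `]-oo, x]%classic `&` `[0%R, 1%R]%classic =
    `[0%R, (Num.min x 1)]%classic.
  apply/seteqP; split=> y /=; rewrite !in_itv/= le_min.
    by move=> [-> /andP[-> ->]].
  by move=> /and3P[-> -> ->].
rewrite lebesgue_measure_itv/= lte_fin; case: ltP => h.
  by rewrite sube0.
by [].
Qed.

Lemma unif_itv01 (A : set R) : measurable A ->
  unif A = unif (A `&` `[0%R, 1%R]%classic).
Proof.
move=> mA; rewrite !unifE//; last exact: measurableI.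
by rewrite -setIA setIid.
Qed.

(** The first binary digit. The strict inequality gives nonzero dyadic points of the unit interval
    the expansion that ends in ones. *)
Definition bit (u : R) : bool := 2^-1 < u.
Definition doubling (u : R) : R := 2 * u - (bit u)%:R.

Lemma measurable_bit : measurable_fun (setT : set (measurableTypeR R)) bit.
Proof. exact: measurable_fun_ltr. Qed.

Lemma measurable_doubling :
  measurable_fun setT (doubling : measurableTypeR R -> measurableTypeR R).
Proof.
apply: measurable_funB; first exact: measurable_funM.
apply: (measurableT_comp (f := fun b : bool => b%:R : R)) => //.
exact: measurable_bit.
Qed.

Let clamp0 (x : R) : x <= 0 -> Num.max 0 (Num.min x 1) = 0.
Proof. by move=> x0; apply/max_idPl; rewrite ge_min x0. Qed.

Let clampx (x : R) : 0 <= x -> x <= 1 -> Num.max 0 (Num.min x 1) = x.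
Proof. by move=> x0 x1; rewrite (min_idPl x1); exact/max_idPr. Qed.

Let clamp1 (x : R) : 1 <= x -> Num.max 0 (Num.min x 1) = 1.
Proof. by move=> x1; rewrite (min_idPr x1); exact/max_idPr. Qed.

(** On each of its two branches [doubling] is affine with slope 2, so a ray pulls back to an
    interval whose part inside the unit interval has half the original length. *)
Lemma unif_bit_doubling_ray (b : bool) (x : R) :
  unif (bit @^-1` [set b] `&` doubling @^-1` `]-oo, x]%classic) =
  (2^-1%:E * unif `]-oo, x]%classic)%E.
Proof.
have lt12 : (2^-1 : R) <= 1 by lra.
case: b.
- have -> : bit @^-1` [set true] `&` doubling @^-1` `]-oo, x]%classic =
      `]-oo, ((x + 1) / 2)]%classic `\` `]-oo, 2^-1]%classic.
    apply/seteqP; split => u /=; rewrite /doubling /bit !in_itv/=.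
      by move=> [h1]; rewrite h1/= => h; split; [lra|apply/negP; rewrite -ltNge].
    by move=> [h1 /negP]; rewrite -ltNge => h2; rewrite h2/=; split => //; lra.
  rewrite measureD//=; last by rewrite (le_lt_trans (probability_le1 _ _)) ?ltry.
  have -> : `]-oo, ((x + 1) / 2)]%classic `&` `]-oo, 2^-1]%classic =
      `]-oo, (Num.min ((x + 1) / 2) 2^-1)]%classic.
    by apply/seteqP; split=> y /=; rewrite !in_itv/= le_min => /andP.
  rewrite !unif_ray -EFinB -EFinM; congr EFin.
  have [x0|x0] := orP (le_total x 0).
    rewrite (min_idPl (_ : (x + 1) / 2 <= 2^-1)); last lra.
    by rewrite (clamp0 x0) subrr mulr0.
  rewrite (min_idPr (_ : 2^-1 <= (x + 1) / 2)); last lra.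
  rewrite (clampx (_ : 0 <= 2^-1) lt12); last lra.
  have [x1|x1] := orP (le_total x 1); first by rewrite !clampx; lra.
  by rewrite !clamp1; lra.
- have -> : bit @^-1` [set false] `&` doubling @^-1` `]-oo, x]%classic =
      `]-oo, (Num.min (x / 2) 2^-1)]%classic.
    apply/seteqP; split => u /=; rewrite /doubling /bit !in_itv/= le_min.
      by move=> [/negbT]; rewrite -leNgt => h1; rewrite ltNge h1/= => h2; lra.
    by move=> /andP[h1 h2]; rewrite ltNge h2/=; split => //; lra.
  rewrite !unif_ray -EFinM; congr EFin.
  have [x0|x0] := orP (le_total x 0).
    rewrite (min_idPl (_ : x / 2 <= 2^-1)); last lra.
    by rewrite !clamp0 ?mulr0//; lra.
  have [x1|x1] := orP (le_total x 1).
    rewrite (min_idPl (_ : x / 2 <= 2^-1)); last lra.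
    by rewrite !clampx; lra.
  rewrite (min_idPr (_ : 2^-1 <= x / 2)); last lra.
  by rewrite clampx ?clamp1; lra.
Qed.

End uniform_distribution.

(** * I.i.d. sequences from iterating a measure-preserving map *)

Section shift_iid.
Context {R : realType} {d d' : measure_display} {T : measurableType d}
  {E : measurableType d'}.
Variables (P : probability T R) (nu : probability E R).

(** The hypothesis contains three facts: [X] has law [nu], [S] preserves [P], and the two are
    independent. The constraints on later terms are an event in [S w], so the first factor splits
    off and induction does the rest. *)
Lemma iid_shift (X : T -> E) (S : T -> T) :
  measurable_fun setT X -> measurable_fun setT S ->
  (forall B C, measurable B -> measurable C ->
     P (X @^-1` B `&` S @^-1` C) = (nu B * P C)%E) ->
  iid_family P nu (fun n w => X (iter n S w)).
Proof.
move=> mX mS XS.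
have mA N (B : nat -> set E) : (forall i, measurable (B i)) ->
    measurable [set w | forall i, (i < N)%N -> B i (X (iter i S w))].
  move=> mB.
  have mit i : measurable_fun setT (iter i S).
    by elim: i => [|i IH]/=; [exact: measurable_id|exact: measurableT_comp].
  rewrite (_ : [set _ | _] =
    \bigcap_(i in [set` iota 0 N]) ((X \o iter i S) @^-1` B i)).
    apply: fin_bigcap_measurable => // i _.
    by rewrite -[X in measurable X]setTI; apply: measurableT_comp.
  apply/seteqP; split=> w /= h i; first by rewrite /= mem_iota/= add0n; exact: h.
  by move=> iN; apply: h; rewrite /= mem_iota.
have step N : forall B : nat -> set E, (forall i, measurable (B i)) ->
    P [set w | forall i, (i < N)%N -> B i (X (iter i S w))] =
    (\prod_(i <- iota 0 N) nu (B i))%E.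
  elim: N => [|N IH] B mB.
    rewrite big_nil -(probability_setT P); congr (P _).
    by apply/seteqP; split.
  have -> : iota 0 N.+1 = 0%N :: map (addn 1) (iota 0 N) by rewrite -iotaDl.
  rewrite big_cons big_map.
  rewrite -(IH (fun i => B (1 + i)%N)) //.
  rewrite -XS//; last exact: (mA N (fun i => B (1 + i)%N) (fun i => mB _)).
  congr (P _); apply/seteqP; split=> w /=.
    by move=> h; split=> [|i iN]; [exact: (h 0%N)|rewrite -iterSr; exact: (h i.+1)].
  by move=> [h0 h] [//|i] iN; rewrite iterSr; exact: h.
move=> s B us mB.
have [N sN] : exists N, forall i, i \in s -> (i < N)%N.
  by exists (\max_(i <- s) i).+1 => i is_; rewrite ltnS; exact: leq_bigmax_seq.
(* Padding with the full set turns an arbitrary index list into an initial segment. *)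
pose B' i := if i \in s then B i else setT.
rewrite (_ : [set _ | _] =
    [set w | forall i, (i < N)%N -> B' i (X (iter i S w))]); last first.
  apply/seteqP; split=> w /= h i iN; first by rewrite /B'; case: ifPn => // /h.
  by have := h _ (sN _ iN); rewrite /B' iN.
rewrite step; last by move=> i; rewrite /B'; case: ifP.
rewrite (eq_bigr (fun i => if i \in s then nu (B i) else 1%E)); last first.
  by move=> i _; rewrite /B'; case: ifP => //; rewrite probability_setT.
rewrite -big_mkcond/= -big_filter; apply: perm_big.
apply: uniq_perm => // [|i]; first exact/filter_uniq/iota_uniq.
rewrite mem_filter mem_iota/= add0n; case: (boolP (i \in s)) => // is_.
by rewrite sN.
Qed.

End shift_iid.

Section iid_transfer.
Context {R : realType} {d d' : measure_display} {T : measurableType d}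
  {E : measurableType d'}.

(** The left inverse [g] carries the sets [B] over to the index set [I]. This serves for
    subsequences, for two-sided sequences and for time shifts. *)
Lemma iid_reindex (P : set T -> \bar R) (nu : set E -> \bar R) (I J : eqType)
    (X : I -> T -> E) (c : J -> I) (g : I -> J) :
  cancel c g -> iid_family P nu X -> iid_family P nu (fun j => X (c j)).
Proof.
move=> cK iX s B us mB.
have := iX (map c s) (fun i => B (g i)).
rewrite (map_inj_uniq (can_inj cK)) us big_map => /(_ isT (fun i => mB (g i))).
rewrite (eq_bigr (fun j => nu (B j))) => [<-|j _]; last by rewrite cK.
congr (P _); apply/seteqP; split=> w /= h.
  by move=> i /mapP[j js ->]; rewrite cK; exact: h.
by move=> j js; rewrite -(cK j) cK; have := h _ (map_f c js); rewrite cK.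
Qed.

(** Pushing a family forward to the sequence space makes families from different spaces comparable
    through [iid_family_unique]. *)
Lemma iid_law (I : eqType) (P : probability T R) (nu : set E -> \bar R)
    (X : I -> T -> E) :
  (forall i, measurable_fun setT (X i)) -> iid_family P nu X ->
  exists Q : probability (seqspace I E) R,
    iid_family Q nu (fun i x => x i) /\
    forall A, measurable A -> Q A = P [set w | A (fun i => X i w)].
Proof.
move=> mX iX.
pose Y : T -> seqspace I E := fun w i => X i w.
have mY : measurable_fun setT Y by exact: measurable_seqspaceP.
pose mY' := isMeasurableFun.Build _ _ _ _ _ mY.
pose Z : {RV P >-> seqspace I E} := HB.pack Y mY'.
by exists (distribution P Z).
Qed.

End iid_transfer.

(** * Independence of the first binary digit and the remainder *)

Section binary_digits.
Context {R : realType}.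
Local Notation unif := (@unif R).

Let mbit := isMeasurableFun.Build _ _ _ _ _ (@measurable_bit R).
Let bitRV : {RV unif >-> bool} := HB.pack (@bit R) mbit.
Definition bit_prob : probability bool R := distribution unif bitRV.

(** For a single digit, [factor_pi_ext] extends the computation on rays; an arbitrary [B] is a
    disjoint union of at most two digits. *)
Lemma unif_bit_doubling (B : set bool) (C : set R) : measurable (C : set (measurableTypeR R)) ->
  unif (bit @^-1` B `&` doubling @^-1` C) = (bit_prob B * unif C)%E.
Proof.
move=> mC.
have mb A : measurable (@bit R @^-1` A : set (measurableTypeR R)).
  by rewrite -[X in measurable X]setTI; exact: measurable_bit.
have md (A : set (measurableTypeR R)) : measurable A ->
    measurable (@doubling R @^-1` A : set (measurableTypeR R)).
  by move=> mA; rewrite -[X in measurable X]setTI; exact: measurable_doubling.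
have half b : unif (bit @^-1` [set b]) = 2^-1%:E.
  have half0 : unif (bit @^-1` [set false]) = 2^-1%:E.
    have -> : bit @^-1` [set false] = `]-oo, (2^-1 : R)]%classic.
      apply/seteqP; split=> u /=; rewrite /bit in_itv/= ltNge; first by move/negbFE.
      by move=> ->.
    rewrite unif_ray; congr EFin.
    by rewrite /Num.max /Num.min; do ! case: ifPn; rewrite -?leNgt; lra.
  case: b => //.
  have -> : bit @^-1` [set true] = ~` (@bit R @^-1` [set false]).
    by apply/seteqP; split=> u /=; case: (bit u).
  apply: etrans (probability_setC unif (mb _)) _.
  transitivity (1 - 2^-1%:E : \bar R)%E; first by rewrite half0.
  by rewrite -EFinB; congr EFin; lra.
have one b : unif (bit @^-1` [set b] `&` doubling @^-1` C) =
    (unif (bit @^-1` [set b]) * unif C)%E.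
  apply: (@factor_pi_ext R _ _ _ _ unif unif (@doubling R) rays
    (bit @^-1` [set b]) (@measurable_doubling R) (@measurable_rays R)
    (@rays_setI R) (mb _) _ C mC).
  by move=> _ [x ->]; rewrite half unif_bit_doubling_ray.
have splitB (F : set (measurableTypeR R)) : measurable F -> unif (bit @^-1` B `&` F) =
   ((if true \in B then unif (bit @^-1` [set true] `&` F) else 0) +
    (if false \in B then unif (bit @^-1` [set false] `&` F) else 0))%E.
  move=> mF.
  have e b : unif (bit @^-1` [set b] `&` (bit @^-1` B `&` F)) =
      if b \in B then unif (bit @^-1` [set b] `&` F) else 0%E.
    case: ifPn => [|]; rewrite ?inE ?notin_setE => Bb.
      congr (unif _); apply/seteqP; split=> u /=; first by move=> [-> []].
      by move=> [ub Fu]; rewrite ub.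
    rewrite -[RHS](measure0 unif); congr (unif _).
    by apply/seteqP; split=> u //= [-> []].
  rewrite -!e -measureU//.
  - congr (unif _); apply/seteqP; split=> u /=; last by case=> -[_].
    by case: (bit u) => -[Bb Fu]; [left|right].
  - by apply: measurableI => //; apply: measurableI.
  - by apply: measurableI => //; apply: measurableI.
  - by apply/seteqP; split=> u //= [[-> _] []].
rewrite (splitB _ (md _ mC)) -[bit_prob B]/(unif (bit @^-1` B)).
rewrite -[in RHS](setIT (bit @^-1` B)) (splitB _ measurableT) !setIT.
rewrite ge0_muleDl; first by congr (_ + _)%E; case: ifP; rewrite ?mul0e ?one.
- by case: ifP.
- by case: ifP.
Qed.

End binary_digits.

(** * Two independent uniform variables from one *)

Section uniform_splitting.
Context {R : realType}.
Local Notation RT := (measurableTypeR R).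
Local Notation unif := (@unif R).

Definition digits (u : RT) : seqspace nat bool :=
  fun n => bit (iter n doubling u).

(** The series is summed in the extended reals, where measurability of sums of nonnegative terms
    applies directly. *)
Definition from_digits (x : seqspace nat bool) : RT :=
  fine (\sum_(i <oo) (((x i)%:R : R) / 2 ^+ i.+1)%:E).

(** The error after [n] digits is the [n]-th iterate scaled by [2 ^- n]. It tends to 0 on the unit
    interval, which [doubling] maps into itself. *)
Lemma digits_partial_sum (u : R) n :
  \sum_(0 <= i < n) ((digits u i)%:R / 2 ^+ i.+1) =
  u - iter n doubling u / 2 ^+ n.
Proof.
elim: n => [|n IH]; first by rewrite big_geq// expr0 divr1 subrr.
rewrite big_nat_recr//= IH /digits [doubling (iter _ _ _)]/doubling !exprS.
by field; rewrite expf_neq0.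
Qed.

Lemma from_digitsK (u : R) : 0 <= u <= 1 -> from_digits (digits u) = u.
Proof.
move=> u01.
have it01 n : 0 <= iter n doubling u <= 1.
  elim: n => //= n /andP[h0 h1]; rewrite /doubling /bit.
  by case: ltP => h /=; apply/andP; split; lra.
rewrite /from_digits; suff -> : (\sum_(i <oo) ((digits u i)%:R / 2 ^+ i.+1)%:E = u%:E)%E by [].
apply/cvg_lim => //.
rewrite (_ : (fun n => _) = EFin \o (fun n => u - iter n doubling u / 2 ^+ n)); last first.
  by apply/funext => n /=; rewrite sumEFin digits_partial_sum.
apply/cvg_EFin; first exact: nearW.
have -> : fine \o (EFin \o (fun n => u - iter n doubling u / 2 ^+ n)) =
   (fun n => u - iter n doubling u / 2 ^+ n) by [].
rewrite -[X in _ --> X]subr0; apply: cvgB; first exact: cvg_cst.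
have half1 : `|2^-1 : R| < 1 by rewrite ger0_norm; lra.
apply: (squeeze_cvgr _ (cvg_cst 0) (cvg_expr half1)).
apply: nearW => n; have /andP[h0 h1] := it01 n.
have p0 : 0 < (2 : R) ^+ n by rewrite exprn_gt0.
by rewrite divr_ge0 ?(ltW p0)//= exprVn ler_pdivrMr// mulVf ?gt_eqF.
Qed.

Lemma measurable_digits : measurable_fun setT digits.
Proof.
have mit i : measurable_fun setT (iter i (doubling : RT -> RT)).
  elim: i => [|i IH]/=; first exact: measurable_id.
  by apply: measurableT_comp => //; exact: measurable_doubling.
by apply: measurable_seqspaceP => i; exact: measurableT_comp measurable_bit (mit i).
Qed.

Lemma measurable_from_digits : measurable_fun setT from_digits.
Proof.
apply: (measurableT_comp (f := fine)) => //.
apply: (@ge0_emeasurable_sum _ _ _ _ _ xpredT).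
  by move=> k x _ _; rewrite lee_fin divr_ge0.
move=> k _; apply/measurable_EFinP; apply: measurable_funM => //.
apply: (measurableT_comp (f := fun b : bool => b%:R : R)) => //.
exact: (@measurable_coord nat _ bool k).
Qed.

Lemma iid_digits :
  iid_family unif (@bit_prob R) (fun n u => bit (iter n doubling u)).
Proof.
apply: (@iid_shift R _ _ RT bool unif (@bit_prob R)).
- exact: measurable_bit.
- exact: measurable_doubling.
- by move=> B C _ mC; exact: unif_bit_doubling.
Qed.

(* X and S read the even and the odd binary digits. *)
Lemma unif_split : exists X S : RT -> RT,
  [/\ measurable_fun setT X, measurable_fun setT S &
   forall A C, measurable A -> measurable C ->
     unif (X @^-1` A `&` S @^-1` C) = (unif A * unif C)%E].
Proof.
pose sub (c : nat -> nat) (x : seqspace nat bool) : seqspace nat bool :=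
  fun n => x (c n).
have msub c : measurable_fun setT (sub c).
  by apply: measurable_seqspaceP => i; exact: measurable_coord.
pose Y c (u : RT) := from_digits (sub c (digits u)).
have mY c : measurable_fun setT (Y c).
  apply: measurableT_comp; first exact: measurable_from_digits.
  by apply: measurableT_comp => //; exact: measurable_digits.
have mdig n : measurable_fun setT (fun u : RT => bit (iter n doubling u)).
  exact: (measurableT_comp (@measurable_coord nat _ bool n) measurable_digits).
have [Q [iQ QE]] := iid_law mdig iid_digits.
have mfd A : measurable A -> measurable (from_digits @^-1` A).
  by move=> mA; rewrite -[X in measurable X]setTI; exact: measurable_from_digits.
(* The digits along an injective [c] are again i.i.d. with law [bit_prob], so reading them gives the
   same law as reading all digits. The latter is uniform, since on the unit interval, which carries
   all the mass, the digits recover the number. *)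
have YE c g A : cancel c g -> measurable A -> unif (Y c @^-1` A) = unif A.
  move=> cK mA.
  have [Q' [iQ' Q'E]] := iid_law (fun n => mdig (c n)) (iid_reindex cK iid_digits).
  transitivity (Q' (from_digits @^-1` A)); first by rewrite Q'E//; exact: mfd.
  rewrite (iid_family_unique iQ' iQ); last exact: mfd.
  rewrite QE; last exact: mfd.
  have mD : measurable [set w : RT | (from_digits @^-1` A) (digits w)].
    rewrite -[X in measurable X]setTI.
    by apply: measurable_digits => //; exact: mfd.
  apply: etrans (unif_itv01 mD) _; apply: etrans _ (esym (unif_itv01 mA)).
  congr (unif _); apply/seteqP; split=> u /=; rewrite in_itv/= => -[h u01];
    by move: h; rewrite from_digitsK.
exists (Y double), (Y (fun n => n.*2.+1)); split => // A C mA mC.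
(* Even and odd indices are complementary, so the two readings depend on disjoint blocks of
   coordinates. *)
pose J : pred nat := fun n => ~~ odd n.
have mA' c D : measurable D -> measurable ((from_digits \o sub c) @^-1` D).
  move=> mD; rewrite -[X in measurable X]setTI.
  by apply: measurableT_comp => //; exact: measurable_from_digits.
have rJ (K : pred nat) c D : (forall n, K (c n)) ->
    restrict_coords K @^-1` ((from_digits \o sub c) @^-1` D) =
    (from_digits \o sub c) @^-1` D.
  move=> Kc; apply/seteqP; split=> x /=;
   by rewrite (_ : sub c (restrict_coords K x) = sub c x)//;
     apply/funext => n; rewrite /sub /restrict_coords Kc.
have JE n : J n.*2 by rewrite /J odd_double.
have JO n : predC J n.*2.+1 by rewrite /J /= odd_double.
have := iid_indep_restrict J iQ (mA' double _ mA) (mA' (fun n => n.*2.+1) _ mC).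
rewrite !rJ// !QE; [|exact: mA'..|by apply: measurableI; exact: mA'].
have halfK : cancel (fun n => n.*2.+1) half by move=> n /=; rewrite uphalf_double.
rewrite -[X in X = _ -> _]/(unif (Y double @^-1` A `&` Y (fun n => n.*2.+1) @^-1` C)).
move=> ->; rewrite -(YE _ _ _ doubleK mA) -(YE _ _ _ halfK mC).
by [].
Qed.

End uniform_splitting.

(** * The quantile transform *)

Section quantile.
Context {R : realType}.
Local Notation RT := (measurableTypeR R).
Variable nu : probability RT R.

(** The generalized inverse [q] of the distribution function satisfies [q u <= x] iff [u <= F x] on
    the open unit interval, where right continuity of [F] gives the forward implication. Hence rays
    have the right probability. *)
Lemma quantile_transform : exists q : RT -> RT,
  measurable_fun setT q /\
  forall A, measurable A -> unif (q @^-1` A) = nu A.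
Proof.
pose F x := fine (nu `]-oo, x]%classic).
have FE x : nu `]-oo, x]%classic = (F x)%:E by rewrite fineK// fin_num_measure.
pose idm := isMeasurableFun.Build _ _ _ _ (idfun : RT -> R) (@measurable_id _ RT setT).
pose Z : {RV nu >-> R} := HB.pack (idfun : RT -> R) idm.
have cdfE x : cdf Z x = (F x)%:E by rewrite -FE.
have Fnd x y : x <= y -> F x <= F y.
  by move=> xy; rewrite -lee_fin -!cdfE; exact: cdf_nondecreasing.
have F0 x : 0 <= F x by rewrite fine_ge0.
have F1 x : F x <= 1 by rewrite -lee_fin -cdfE cdf_le1.
have Flarge u : u < 1 -> exists x, u <= F x.
  move=> u1; have := cvg_cdfy1 Z.
  have -> : cdf Z = EFin \o F by apply/funext => x; rewrite cdfE.
  move=> /fine_cvgP[_] /cvgr_gt /(_ _ u1)[M [_ hM]].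
  by exists (M + 1); apply/ltW/(hM (M + 1)); lra.
have Fsmall u : 0 < u -> exists x, F x < u.
  move=> u0; have := cvg_cdfNy0 Z.
  have -> : cdf Z = EFin \o F by apply/funext => x; rewrite cdfE.
  move=> /fine_cvgP[_] /cvgr_lt /(_ _ u0)[M [_ hM]].
  by exists (M - 1); apply/(hM (M - 1)); lra.
have Fright x u : F x < u -> exists2 e, 0 < e & F (x + e) < u.
  move=> xu; have := @cdf_right_continuous _ _ _ _ Z x.
  have -> : cdf Z = EFin \o F by apply/funext => y; rewrite cdfE.
  move=> /fine_cvgP[_] /cvgr_lt /(_ _ xu)[e /= e0 he].
  exists (e / 2); first by rewrite divr_gt0.
  apply: he => /=; last by rewrite ltrDl divr_gt0.
  by rewrite opprD addrA subrr add0r normrN gtr0_norm ?divr_gt0//; lra.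
(* For [u] strictly between 0 and 1 the set is nonempty and bounded below; the default 0 elsewhere
   concerns a null set. *)
pose q (u : R) : R := if (0 < u) && (u < 1) then inf [set x | u <= F x] else 0.
have qle u x : 0 < u < 1 -> (q u <= x) = (u <= F x).
  move=> u01; have /andP[u0 u1] := u01.
  have lb : has_lbound [set x | u <= F x].
    have [y yu] := Fsmall _ u0; exists y => z /= uz.
    rewrite leNgt; apply/negP => /ltW /Fnd; rewrite leNgt => /negP; apply.
    exact: lt_le_trans uz.
  rewrite /q u01; apply/idP/idP => [h|h]; last exact: ge_inf.
  rewrite leNgt; apply/negP => /Fright[e e0 xe].
  have [z /= uz] : exists2 z, u <= F z & z < x + e.
    have [z uz zx] : exists2 z, [set x | u <= F x] z & z < inf [set x | u <= F x] + e.
      apply: inf_adherent => //; split => //.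
      by have [z uz] := Flarge _ u1; exists z.
    by exists z => //; apply: lt_le_trans zx _; rewrite lerD2r.
  move=> /ltW /Fnd; rewrite leNgt => /negP; apply.
  exact: lt_le_trans uz.
have qray x : q @^-1` `]-oo, x]%classic =
    (`]0%R, 1%R[%classic `&` `]-oo, F x]%classic) `|`
    (~` `]0%R, 1%R[%classic `&` [set _ | 0 <= x]).
  apply/seteqP; split=> u /=; rewrite !in_itv/=.
    have [u01|u01] := boolP (0 < u < 1); first by rewrite qle//; left.
    by rewrite /q (negbTE u01); right.
  move=> [[u01]|[/negP/negbTE u01]]; first by rewrite qle.
  by rewrite /q u01.
have mq : measurable_fun setT (q : RT -> RT).
  apply: (@measurability _ _ _ _ setT (q : RT -> RT) rays (@measurable_rays R)).
  move=> _ [_ [x ->] <-]; rewrite setTI qray.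
  apply: measurableU; apply: measurableI => //; first exact: measurableC.
  have [x0|x0] := leP 0 x.
    by rewrite (_ : [set _ | _] = setT)//; apply/seteqP; split.
  by rewrite (_ : [set _ | _] = set0)//; apply/seteqP; split.
exists q; split => //.
pose Q : {RV unif >-> RT} := HB.pack (q : RT -> RT) (isMeasurableFun.Build _ _ _ _ _ mq).
apply: (@rays_unique R (distribution unif Q) nu).
  by rewrite (le_lt_trans (probability_le1 _ _)) ?ltry.
move=> x; apply: etrans _ (esym (FE x)).
have -> : (F x)%:E = unif `]-oo, F x]%classic.
  by rewrite unif_ray; congr EFin; rewrite (min_idPl (F1 x)) (max_idPr (F0 x)).
pose I01 : set RT := `]0%R, 1%R[%classic.
have mI : measurable I01 by exact: measurable_itv.
have I1 : unif I01 = 1%E.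
  apply: etrans (unifE mI) _; rewrite setIidl; last first.
    by move=> u; rewrite /= !in_itv/= => /andP[/ltW-> /ltW->].
  by rewrite lebesgue_measure_itv/= lte_fin ltr01 sube0.
have restr (A : set RT) : measurable A -> unif A = unif (A `&` I01).
  move=> mA; have mAI : measurable (A `&` I01) by exact: measurableI.
  have mAC : measurable (A `&` ~` I01).
    by apply: measurableI => //; exact: measurableC.
  rewrite -[in LHS](setUIDK A I01) setDE measureU//; last first.
    by rewrite setIACA setICr setI0.
  rewrite [X in (_ + X)%E](_ : _ = 0%E) ?adde0//.
  apply/eqP; rewrite eq_le measure_ge0 andbT.
  apply: (@le_trans _ _ (unif (~` I01))).
    by apply: le_measure; rewrite ?inE//; exact: measurableC.
  rewrite (_ : unif (~` I01) = (1 - unif I01)%E); first by rewrite I1 subee.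
  exact: probability_setC.
have mqr : measurable (q @^-1` `]-oo, x]%classic : set RT).
  by rewrite -[X in measurable X]setTI; exact: (mq).
apply: etrans (restr _ mqr) _.
rewrite [RHS]restr//; congr (unif _).
apply/seteqP; split=> u /= [h uI]; split => //; move: (uI) h;
  by rewrite /I01/= !in_itv/= => u01; rewrite qle.
Qed.

End quantile.

(** Split a uniform variable into [X] and an independent uniform [S], then split [S] again, and so
    on. The quantile transform installs the law [nu], and [pickle] injects the integers into the
    naturals to index a two-sided sequence. *)
Lemma iid_exists (R : realType) (nu : probability (measurableTypeR R) R) :
  exists P : probability (seqspace int (measurableTypeR R)) R,
    iid_family P nu (fun t w => w t).
Proof.
have [q [mq qE]] := quantile_transform nu.
have [X [S [mX mS XS]]] := @unif_split R.
have iX : iid_family (@unif R) nu (fun n u => q (X (iter n S u))).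
  apply: (@iid_shift R _ _ _ _ (@unif R) nu (q \o X)) => //.
    exact: measurableT_comp.
  move=> B C mB mC; rewrite comp_preimage XS ?qE//.
  by rewrite -[X in measurable X]setTI; exact: mq.
have cK : cancel (@pickle int) (fun n => odflt 0 (unpickle n)).
  by move=> i; rewrite pickleK.
have mXn (i : int) : measurable_fun setT (fun u => q (X (iter (pickle i) S u))).
  apply: (measurableT_comp mq); apply: (measurableT_comp mX).
  by elim: (pickle i) => [|n IH]/=; [exact: measurable_id|exact: measurableT_comp].
have [Q [iQ _]] := iid_law mXn (iid_reindex cK iX).
by exists Q.
Qed.

(** * Moments and the threshold condition *)

Section moments.
Context {R : realType}.
Variable nu : probability (measurableTypeR R) R.
Local Notation M s := (fine (moment nu s)).

Lemma momentE s : moment nu s = (\int[nu]_e (e ^+ (2 * s))%:E)%E.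
Proof. by rewrite /moment unlock. Qed.

Lemma even_exp_ge0 (e : R) s : 0 <= e ^+ (2 * s).
Proof. by rewrite exprM exprn_ge0// sqr_ge0. Qed.

Lemma moment_ge0 s : (0 <= moment nu s)%E.
Proof.
by rewrite momentE; apply: integral_ge0 => e _; rewrite lee_fin even_exp_ge0.
Qed.

Lemma fine_moment_ge0 s : 0 <= M s.
Proof. by rewrite fine_ge0// moment_ge0. Qed.

Lemma moment_fineK s : (moment nu s < +oo)%E -> moment nu s = (M s)%:E.
Proof. by move=> h; rewrite fineK// ge0_fin_numE// moment_ge0. Qed.

(** Hoelder with exponents [m] and [m / (m - 1)] for the factors [e ^+ (2 * p)] and
    [e ^+ (2 * (m - 1))], whose powers are the integrands of orders [2 * m * p] and [2 * m]. *)
Lemma moment_hoelder (p m : nat) : (1 <= m)%N ->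
  (moment nu m < +oo)%E -> (moment nu (m * p) < +oo)%E ->
  (moment nu (p + (m - 1)) <=
    (M m `^ (1 - m%:R^-1) * M (m * p) `^ (m%:R^-1))%:E)%E.
Proof.
move=> m1 Mm Mmp.
(* For [m = 1] the conjugate exponent would be infinite; the bound is then an equality. *)
have [m_eq1|m_neq1] := eqVneq m 1%N.
  rewrite m_eq1 in Mm Mmp *.
  rewrite mul1n in Mmp *.
  rewrite invr1 subrr powRr0 mul1r powRr1 ?fine_moment_ge0// -moment_fineK//.
  by rewrite subnn addn0.
have m2 : (1 < m)%N by rewrite ltn_neqAle eq_sym m_neq1.
pose f (e : measurableTypeR R) : R := e ^+ (2 * p).
pose g (e : measurableTypeR R) : R := e ^+ (2 * (m - 1)).
have mR0 : 0 < m%:R :> R by rewrite ltr0n.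
have m1R0 : 0 < (m - 1)%:R :> R by rewrite ltr0n subn_gt0.
have m1RE : (m - 1)%:R = m%:R - 1 :> R by rewrite natrB.
pose q : R := m%:R / (m - 1)%:R.
have q0 : 0 < q by rewrite divr_gt0.
have pq : (m%:R)^-1 + q^-1 = 1 :> R.
  by rewrite /q invf_div m1RE mulrBl mulfV ?gt_eqF// mul1r addrC subrK.
have mf : measurable_fun setT f by exact: measurable_funX.
have mg : measurable_fun setT g by exact: measurable_funX.
have := hoelder nu mf mg mR0 q0 pq.
rewrite Lnorm1.
have -> : (\int[nu]_x `|(EFin \o (f \* g)%R) x| = moment nu (p + (m - 1)))%E.
  rewrite momentE; apply: eq_integral => e _ /=.
  by rewrite /f /g -exprD -mulnDr ger0_norm// even_exp_ge0.
move=> /le_trans; apply.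
have -> : Lnorm nu m%:R%:E (EFin \o f) = (M (m * p) `^ m%:R^-1)%:E.
  rewrite unlock /= -poweR_EFin -moment_fineK// momentE; congr (poweR _ _).
  apply: eq_integral => e _ /=; congr EFin.
  by rewrite ger0_norm ?even_exp_ge0// powR_mulrn ?even_exp_ge0// /f -exprM -mulnA (mulnC p).
have -> : Lnorm nu q%:E (EFin \o g) = (M m `^ (1 - m%:R^-1))%:E.
  rewrite unlock /= -poweR_EFin -moment_fineK// momentE.
  have -> : q^-1 = 1 - m%:R^-1 by apply/eqP; rewrite eq_sym subr_eq addrC pq.
  congr (poweR _ _).
  apply: eq_integral => e _ /=; congr EFin.
  rewrite ger0_norm ?even_exp_ge0// /g exprM exprM.
  rewrite -(powR_mulrn _ (sqr_ge0 e)) -powRrM /q mulrCA mulfV ?gt_eqF// mulr1.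
  by rewrite powR_mulrn// sqr_ge0.
by rewrite muleC -EFinM.
Qed.

(* The witness is s = m - 1 for an m whose term exceeds alpha. *)
Lemma threshold_witness (p : nat) (alpha k : R) :
  (1 <= p)%N -> 0 <= alpha -> 0 <= k -> (moment nu p < +oo)%E ->
  (alpha%:E < moment_threshold nu p k)%E ->
  exists s, (moment nu (p + s) < +oo)%E /\
    alpha ^+ (2 * p + s) * M p * M (p + s) < k ^+ s.
Proof.
move=> p1 a0 k0 Mp /ereal_sup_gt[_ [m /= m1 <-]]; rewrite lte_fin /moment_term.
case: ifPn => [/andP[Mm Mmp] alt|_]; last by rewrite ltNge a0.
exists (m - 1)%N.
have H := moment_hoelder m1 Mm Mmp.
have Hoo : (moment nu (p + (m - 1)) < +oo)%E by rewrite (le_lt_trans H)// ltry.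
split => //.
set h := M m `^ _ * _ in H.
have h0 : 0 <= h by rewrite mulr_ge0// powR_ge0.
have HR : M (p + (m - 1)) <= h by rewrite -lee_fin -moment_fineK.
rewrite -mulrA -/h in alt; set A := M p * h in alt.
have A0 : 0 <= A by rewrite mulr_ge0// fine_moment_ge0.
pose n := (2 * p + m - 1)%N.
have nE : n = (2 * p + (m - 1))%N by rewrite /n addnBA.
have n0 : (0 < n)%N by rewrite nE addn_gt0 muln_gt0 p1.
rewrite -/n in alt.
have B0 : 0 <= k ^+ (m - 1) / A by rewrite divr_ge0// exprn_ge0.
have an : alpha ^+ n < k ^+ (m - 1) / A.
  rewrite -(powR_mulrn n a0).
  have -> : k ^+ (m - 1) / A = ((k ^+ (m - 1) / A) `^ n%:R^-1) `^ n%:R.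
    by rewrite -powRrM mulVf ?powRr1// pnatr_eq0 -lt0n.
  by apply: gt0_ltr_powR; rewrite ?ltr0n// nnegrE// powR_ge0.
(* The inverse of 0 is 0, so a vanishing [A] would make the strict bound [an] read as a power of
   [alpha] below 0. *)
have Agt0 : 0 < A.
  rewrite lt0r A0 andbT; apply/eqP => A_eq0; move: an.
  by rewrite A_eq0 invr0 mulr0 ltNge exprn_ge0.
rewrite -nE; move: an; rewrite ltr_pdivlMr//; apply: le_lt_trans.
by rewrite -mulrA ler_wpM2l ?exprn_ge0// ler_wpM2l// fine_moment_ge0.
Qed.

Lemma integral_even_le (h : measurableTypeR R -> R) (a b c : R) (i j : nat) :
  0 <= a -> 0 <= b -> 0 <= c ->
  (moment nu i < +oo)%E -> (moment nu j < +oo)%E ->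
  measurable_fun setT h -> (forall e, 0 <= h e) ->
  (forall e, h e <= a * e ^+ (2 * i) + b * e ^+ (2 * j) + c) ->
  (\int[nu]_e (h e)%:E <= (a * M i + b * M j + c)%:E)%E.
Proof.
move=> a0 b0 c0 Mi Mj mh h0 hle.
have meven n : measurable_fun setT (fun e : measurableTypeR R => (e ^+ (2 * n))%:E : \bar R).
  by apply/measurable_EFinP; exact: measurable_funX.
have mZ (x : R) n : 0 <= x -> (\int[nu]_e (x%:E * (e ^+ (2 * n))%:E) = x%:E * moment nu n)%E.
  move=> x0; rewrite ge0_integralZl//; first by rewrite momentE.
  by move=> e _; rewrite lee_fin even_exp_ge0.
have mcZ (x : R) n : measurable_fun setT
    (fun e : measurableTypeR R => x%:E * (e ^+ (2 * n))%:E)%E.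
  exact: measurable_funeM.
apply: (@le_trans _ _
  (\int[nu]_e (a%:E * (e ^+ (2 * i))%:E + b%:E * (e ^+ (2 * j))%:E + c%:E))%E).
  apply: ge0_le_integral => //.
  - by move=> e _; rewrite lee_fin.
  - exact/measurable_EFinP.
  - by apply: emeasurable_funD => //; exact: emeasurable_funD.
  - by move=> e _; rewrite -!EFinM -!EFinD lee_fin.
have nn (x : R) n (e : R) : 0 <= x -> (0 <= x%:E * (e ^+ (2 * n))%:E :> \bar R)%E.
  by move=> x0; rewrite -EFinM lee_fin mulr_ge0// even_exp_ge0.
rewrite ge0_integralD//; last 2 first.
- by move=> e _; rewrite adde_ge0// nn.
- exact: emeasurable_funD.
rewrite ge0_integralD//; [|by move=> e _; exact: nn..].
rewrite !mZ// integral_cst//= probability_setT mule1.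
by rewrite !EFinD !EFinM -!moment_fineK.
Qed.

End moments.

(** * The Markov chain and its drift *)

(** If [a <= eps * b] the sum is at most [(1 + eps) * b], otherwise it is at most a multiple of [a].
    This removes the additive constant [omega] from powers at the cost of a factor close to 1. *)
Lemma expD_le_split (R : realFieldType) (p : nat) (tau : R) : 0 < tau ->
  exists2 K : R, 0 <= K & forall a b : R, 0 <= a -> 0 <= b ->
    (a + b) ^+ p <= (1 + tau) * b ^+ p + K * a ^+ p.
Proof.
move=> tau0.
have [eps eps0 epsE] : exists2 eps : R, 0 < eps & (1 + eps) ^+ p <= 1 + tau.
  elim: p tau tau0 => [|p IH] tau tau0; first by exists 1 => //; rewrite expr0; lra.
  have [|eps eps0 He] := IH (Num.min (tau / 3) 1).
    by rewrite lt_min ltr01 divr_gt0.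
  exists (Num.min eps (Num.min (tau / 3) 1)).
    by rewrite !lt_min eps0 ltr01 divr_gt0.
  set m := Num.min (tau / 3) 1 in He *.
  have m1 : m <= 1 by rewrite ge_min lexx orbT.
  have mt : m <= tau / 3 by rewrite ge_min lexx.
  have m0 : 0 < m by rewrite lt_min ltr01 divr_gt0.
  set e := Num.min eps m.
  have ee : e <= eps by rewrite ge_min lexx.
  have em : e <= m by rewrite ge_min lexx orbT.
  have e0 : 0 < e by rewrite lt_min eps0.
  have h : (1 + e) ^+ p <= 1 + m.
    by apply: le_trans He; rewrite lerXn2r ?nnegrE; lra.
  rewrite exprS; apply: (@le_trans _ _ ((1 + m) * (1 + m))); last by nra.
  by apply: ler_pM; rewrite ?exprn_ge0//; lra.
exists ((1 + eps^-1) ^+ p) => [|a b a0 b0].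
  by rewrite exprn_ge0// addr_ge0// invr_ge0 ltW.
have ei : 0 < eps^-1 by rewrite invr_gt0.
have [ab|ab] := leP a (eps * b).
- apply: (@le_trans _ _ ((1 + tau) * b ^+ p)).
    apply: (@le_trans _ _ ((1 + eps) ^+ p * b ^+ p)).
      rewrite -exprMn lerXn2r ?nnegrE ?mulrDl ?mul1r ?[b + _]addrC ?lerD//.
        exact: addr_ge0.
      by rewrite addr_ge0// mulr_ge0// ltW.
    by rewrite ler_wpM2r// exprn_ge0.
  by rewrite lerDl mulr_ge0// exprn_ge0//; lra.
- apply: (@le_trans _ _ ((1 + eps^-1) ^+ p * a ^+ p)); last first.
    by rewrite lerDr mulr_ge0// ?exprn_ge0//; lra.
  rewrite -exprMn lerXn2r ?nnegrE ?addr_ge0// ?mulr_ge0//; first lra.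
  rewrite mulrDl mul1r lerD2l -ler_pdivrMl ?invr_gt0// invrK.
  exact: ltW.
Qed.

Section threshold_arch.
Context {R : realType}.
Variables (omega alpha k : R).
Hypotheses (omega0 : 0 < omega) (alpha0 : 0 <= alpha) (k0 : 0 <= k).

(* The state at time t is the pair (eps_t^2, sigma_(t+1)^2). *)
Definition tarch_step (x : R * R) (e : R) : R * R :=
  (x.2 * e ^+ 2, omega + alpha * (x.2 * e ^+ 2) * (k * x.1 < x.2 * e ^+ 2)%R%:R).

(** An invariant set of the chain. Its last bound lets the volatility be estimated by the preceding
    squared value. *)
Definition admissible (x : R * R) : Prop :=
  [/\ 0 <= x.1, omega <= x.2 & x.2 <= omega + alpha * x.1].

Lemma admissible_init : admissible (0, omega).
Proof. by split => //=; rewrite mulr0 addr0. Qed.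

Lemma admissible_step x e : admissible x -> admissible (tarch_step x e).
Proof.
move=> [x1 x2 x3]; have y0 : 0 <= x.2 * e ^+ 2.
  by rewrite mulr_ge0 ?sqr_ge0//; exact: le_trans (ltW omega0) x2.
rewrite /tarch_step; split => //=; case: (_ < _) => /=;
  rewrite ?mulr1 ?mulr0 ?addr0 ?lerDl//; exact: mulr_ge0.
Qed.

Definition lyap (p : nat) (lam : R) (x : R * R) : R := x.1 ^+ p + lam * x.2 ^+ p.

Lemma lyap_ge0 p lam x : 0 <= lam -> admissible x -> 0 <= lyap p lam x.
Proof.
move=> l0 [x1 x2 _]; rewrite /lyap addr_ge0 ?exprn_ge0// mulr_ge0// exprn_ge0//.
exact: le_trans (ltW omega0) x2.
Qed.

Lemma measurable_tarch_step d (T : measurableType d) (X : T -> R * R) (eta : T -> R) :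
  measurable_fun setT X -> measurable_fun setT eta ->
  measurable_fun setT (fun w => tarch_step (X w) (eta w)).
Proof.
move=> mX me.
have m1 : measurable_fun setT (fun w => (X w).1) by exact: measurableT_comp.
have m2 : measurable_fun setT (fun w => (X w).2) by exact: measurableT_comp.
have my : measurable_fun setT (fun w => (X w).2 * eta w ^+ 2).
  by apply: measurable_funM => //; exact: measurable_funX.
apply: measurable_fun_pair => //=.
apply: measurable_funD => //; apply: measurable_funM.
  exact: measurable_funM.
apply: (measurableT_comp (f := fun b : bool => b%:R : R)) => //.
by apply: measurable_fun_ltr => //; exact: measurable_funM.
Qed.

Lemma measurable_lyap d (T : measurableType d) (X : T -> R * R) p lam :
  measurable_fun setT X -> measurable_fun setT (fun w => lyap p lam (X w)).
Proof.
move=> mX; apply: measurable_funD.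
  by apply: measurable_funX; exact: measurableT_comp.
by apply: measurable_funM => //; apply: measurable_funX; exact: measurableT_comp.
Qed.

(** * The Lyapunov drift inequality *)

Section drift.
Variable nu : probability (measurableTypeR R) R.
Local Notation M s := (fine (moment nu s)).
Variables (p s : nat).
Hypotheses (p1 : (1 <= p)%N) (Mp : (moment nu p < +oo)%E)
  (Mps : (moment nu (p + s) < +oo)%E)
  (crit : alpha ^+ (2 * p + s) * M p * M (p + s) < k ^+ s).

Let ks0 : 0 < k ^+ s.
Proof.
by apply: le_lt_trans crit; rewrite !mulr_ge0 ?exprn_ge0 ?fine_moment_ge0.
Qed.

(** The strict inequality [crit] survives a small perturbation, by continuity of a polynomial at 0.
    The same [tau] pays for three losses: [lam] above [M p], the factor of [expD_le_split], and the
    absorption of [omega] into the slope. *)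
Let slack : exists2 tau : R, 0 < tau &
  (M p + tau) * ((1 + tau) * alpha ^+ p * (alpha + tau) ^+ (p + s) * M (p + s))
    < k ^+ s.
Proof.
pose P : {poly R} := ((M p)%:P + 'X) * ((1 + 'X) * (alpha ^+ p)%:P *
  (alpha%:P + 'X) ^+ (p + s) * (M (p + s))%:P).
have PE x : P.[x] = (M p + x) * ((1 + x) * alpha ^+ p * (alpha + x) ^+ (p + s) *
    M (p + s)).
  by rewrite /P !hornerE.
have P0 : P.[0] < k ^+ s.
  have aE : alpha ^+ (2 * p + s) = alpha ^+ p * alpha ^+ (p + s).
    by rewrite -exprD addnA addnn mul2n.
  by move: crit; rewrite PE aE !addr0; congr (_ < _); ring.
have := @continuous_horner R P 0.
move=> /cvgr_lt /(_ _ P0)[e /= e0 he].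
exists (e / 2); first by rewrite divr_gt0.
rewrite -PE; apply: he => /=.
by rewrite sub0r normrN gtr0_norm ?divr_gt0//; lra.
Qed.

(** One step turns [x.2 ^+ p] into at most [M p] times itself in the first component, and for large
    [x.1] it turns [x.1 ^+ p] into [rho0] times itself in the second. Weighting the second component
    by [lam] makes both factors contract if [M p < lam] and [lam * rho0 < 1]. *)
Lemma lyap_drift : exists lam rho C : R,
  [/\ 0 < lam, 0 <= rho < 1, 0 <= C &
   forall x, admissible x ->
     (\int[nu]_e (lyap p lam (tarch_step x e))%:E <= (rho * lyap p lam x + C)%:E)%E].
Proof.
have o0 := omega0; have a0 := alpha0.
have [tau tau0 tauE] := slack.
have [K K0 KE] := expD_le_split p tau0.
have Mp0 := fine_moment_ge0 nu p; have Mps0 := fine_moment_ge0 nu (p + s).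
pose lam := M p + tau; have lam0 : 0 < lam by rewrite /lam; lra.
pose gam : R := (1 + tau) * alpha ^+ p * (alpha + tau) ^+ (p + s) / k ^+ s.
have gam0 : 0 <= gam.
  by rewrite divr_ge0 ?(ltW ks0)// !mulr_ge0 ?exprn_ge0//; lra.
pose rho0 : R := gam * M (p + s).
have rho00 : 0 <= rho0 by rewrite mulr_ge0.
have lrho : lam * rho0 < 1.
  rewrite /rho0 /gam mulrAC mulrA ltr_pdivrMr// mul1r.
  by move: tauE; rewrite /lam.
pose rho := Num.max (M p / lam) (lam * rho0).
(* Beyond [L] one has [omega <= tau * x.1], hence [x.2 <= (alpha + tau) * x.1]; below [L] the
   volatility is bounded. *)
pose L := omega / tau; have L0 : 0 < L by rewrite divr_gt0.
pose b : R := (1 + tau) * alpha ^+ p * (omega + alpha * L) ^+ p.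
have oL : 0 <= omega + alpha * L by exact: addr_ge0 (ltW o0) (mulr_ge0 a0 (ltW L0)).
have b0 : 0 <= b by rewrite !mulr_ge0 ?exprn_ge0//; lra.
pose C := lam * (b * M p) + lam * (K * omega ^+ p).
have lbM : 0 <= lam * (b * M p) := mulr_ge0 (ltW lam0) (mulr_ge0 b0 Mp0).
have lK : 0 <= lam * (K * omega ^+ p).
  exact: mulr_ge0 (ltW lam0) (mulr_ge0 K0 (exprn_ge0 _ (ltW o0))).
exists lam, rho, C; split => //.
- rewrite /rho le_max (mulr_ge0 (ltW lam0) rho00) orbT /= gt_max lrho andbT.
  by rewrite ltr_pdivrMr// mul1r /lam; lra.
- exact: addr_ge0.
move=> x ax; have [x1 x2 x3] := ax.
have x20 : 0 <= x.2 by exact: le_trans (ltW omega0) x2.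
pose I e := (k * x.1 < x.2 * e ^+ 2)%R.
have y0 e : 0 <= x.2 * e ^+ 2 by exact: mulr_ge0 x20 (sqr_ge0 e).
have yI e : 0 <= x.2 * e ^+ 2 * (I e)%:R by exact: mulr_ge0 (y0 e) (ler0n _ _).
have lyap_le e : lyap p lam (tarch_step x e) <=
    x.2 ^+ p * e ^+ (2 * p) + lam * ((1 + tau) * alpha ^+ p *
      (x.2 * e ^+ 2 * (I e)%:R) ^+ p) + lam * (K * omega ^+ p).
  rewrite /lyap /tarch_step /= exprMn -exprM -addrA lerD2l -mulrDr ler_pM2l//.
  rewrite -[alpha * _ * _]mulrA -/(I e).
  apply: le_trans (KE omega (alpha * (x.2 * e ^+ 2 * (I e)%:R)) (ltW omega0) _) _.
    exact: mulr_ge0 a0 (yI e).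
  by rewrite exprMn mulrA.
have rhole y : M p * x.2 ^+ p + lam * (rho0 * x.1 ^+ p) + y <=
   rho * lyap p lam x + y.
  rewrite lerD2r /lyap mulrDr addrC lerD//.
    by rewrite mulrA ler_wpM2r ?exprn_ge0// /rho le_max lexx orbT.
  rewrite mulrA ler_wpM2r ?exprn_ge0// -ler_pdivrMr//.
  by rewrite /rho le_max lexx.
have mh : measurable_fun (setT : set (measurableTypeR R)) (fun e => lyap p lam (tarch_step x e)).
  by apply: measurable_lyap; exact: measurable_tarch_step.
have h0 e : 0 <= lyap p lam (tarch_step x e).
  by apply: lyap_ge0; [exact: ltW|exact: admissible_step].
have [xL|xL] := leP L x.1.
- have vle : x.2 <= (alpha + tau) * x.1.
    apply: le_trans x3 _; rewrite mulrDl addrC lerD2l.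
    by move: xL; rewrite /L ler_pdivrMr// mulrC.
  have x10 : 0 < x.1 by lra.
  apply: le_trans (@integral_even_le _ nu _ (x.2 ^+ p) (lam * (gam * x.1 ^+ p))
    (lam * (K * omega ^+ p)) p (p + s) _ _ _ Mp Mps mh h0 _) _.
  + exact: exprn_ge0.
  + exact: mulr_ge0 (ltW lam0) (mulr_ge0 gam0 (exprn_ge0 _ x1)).
  + exact: lK.
  + move=> e; apply: le_trans (lyap_le e) _.
    rewrite lerD2r lerD2l -[lam * _ * _]mulrA ler_pM2l//.
    have -> : gam * x.1 ^+ p * e ^+ (2 * (p + s)) = (1 + tau) * alpha ^+ p *
        ((alpha + tau) ^+ (p + s) * ((k ^+ s)^-1 * (x.1 ^+ p * e ^+ (2 * (p + s))))).
      by rewrite /gam; ring.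
    apply: ler_wpM2l; first by rewrite mulr_ge0 ?exprn_ge0//; lra.
    have := y0 e; set y := x.2 * e ^+ 2 => y00.
    have yle : y ^+ (p + s) <= (alpha + tau) ^+ (p + s) * x.1 ^+ (p + s) * e ^+ (2 * (p + s)).
      rewrite exprM -!exprMn lerXn2r ?nnegrE//; last first.
        by rewrite /y ler_wpM2r ?sqr_ge0.
      by rewrite mulr_ge0 ?sqr_ge0// mulr_ge0//; lra.
    have rhs0 : 0 <= (alpha + tau) ^+ (p + s) *
        ((k ^+ s)^-1 * (x.1 ^+ p * e ^+ (2 * (p + s)))).
      apply: mulr_ge0; first by rewrite exprn_ge0//; lra.
      apply: mulr_ge0; first by rewrite invr_ge0 ltW.
      exact: mulr_ge0 (exprn_ge0 _ x1) (even_exp_ge0 _ _).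
    have [Ie|nIe] := boolP (I e); last first.
      (* Off the event the power of 0 is 0 because [p] is positive. *)
      by rewrite mulr0 expr0n eqn0Ngt p1.
    rewrite mulr1.
    (* On the event [k * x.1 < y], so [y ^+ p * (k * x.1) ^+ s] is at most [y ^+ (p + s)]: the
       indicator is exchanged for [s] further powers of [y]. *)
    rewrite -(ler_pM2r (mulr_gt0 ks0 (exprn_gt0 s x10))).
    apply: (@le_trans _ _ (y ^+ (p + s))).
      rewrite exprD; apply: ler_wpM2l; first exact: exprn_ge0.
      rewrite -exprMn; apply: lerXn2r; rewrite ?nnegrE//; first exact: mulr_ge0.
      exact: ltW Ie.
    apply: le_trans yle _; rewrite le_eqVlt; apply/orP; left; apply/eqP.
    have := lt0r_neq0 ks0; set ks := k ^+ s => ks_neq0.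
    by rewrite [x.1 ^+ (p + s)]exprD; field.
  + rewrite lee_fin; apply: le_trans (rhole C).
    rewrite /C addrA lerD2r [M p * _]mulrC -addrA lerD2l.
    rewrite -mulrDr -mulrA ler_pM2l// /rho0 mulrAC lerDl mulr_ge0//.
- apply: le_trans (@integral_even_le _ nu _ (x.2 ^+ p) (lam * b)
    (lam * (K * omega ^+ p)) p p _ _ _ Mp Mp mh h0 _) _.
  + exact: exprn_ge0.
  + exact: mulr_ge0 (ltW lam0) b0.
  + exact: lK.
  + move=> e; apply: le_trans (lyap_le e) _.
    rewrite lerD2r lerD2l -[lam * _ * _]mulrA ler_pM2l// /b -[leRHS]mulrA.
    apply: ler_wpM2l; first by rewrite mulr_ge0 ?exprn_ge0//; lra.
    rewrite exprM -exprMn lerXn2r ?nnegrE//.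
    * exact: mulr_ge0 oL (sqr_ge0 e).
    * apply: (@le_trans _ _ (x.2 * e ^+ 2)).
        by rewrite ler_piMr ?y0//; case: (I e).
      rewrite ler_wpM2r ?sqr_ge0//; apply: le_trans x3 _.
      by rewrite lerD2l ler_wpM2l// ltW.
  + rewrite lee_fin; apply: le_trans (rhole C).
    have h := mulr_ge0 (ltW lam0) (mulr_ge0 rho00 (exprn_ge0 p x1)).
    by rewrite /C; lra.
Qed.

End drift.
End threshold_arch.

(** * Coupling *)

Section coupling.
Context {R : realType}.
Variables (omega alpha k : R) (p : nat) (lam : R).
Local Notation step := (tarch_step omega alpha k).
Local Notation adm := (admissible omega alpha).
Local Notation V := (lyap p lam).
Implicit Types (z : (R * R) * (R * R)).

Definition coupled_step z e := (step z.1 e, step z.2 e).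

Definition apart z : bool := ~~ ((z.1.1 == z.2.1) && (z.1.2 == z.2.2)).

(** Where both copies land after a moderate innovation. The lower bounds keep both thresholds above
    [k * omega]; the bounds by [V2] say how small the next innovation must be to stay below them. *)
Definition stage2 (Y2 V2 : R) z : bool :=
  [&& omega <= z.1.1, z.1.1 <= Y2, omega <= z.2.1, z.2.1 <= Y2,
      z.1.2 <= V2 & z.2.2 <= V2].

(** Where both copies land after a small innovation: the volatilities agree already, and the first
    components matter only through thresholds of at most [k ^+ 2 * omega]. *)
Definition stage3 z : bool :=
  [&& z.1.2 == omega, z.2.2 == omega, z.1.1 <= k * omega & z.2.1 <= k * omega].

(* The two bonuses c2 and c3 reward the intermediate stages on the way to
   coalescence, so that a one-step contraction replaces a three-step one. *)
Definition coupling_fun (theta c2 c3 Y2 V2 : R) z : R :=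
  (apart z)%:R * (1 + theta * (V z.1 + V z.2) - c2 * (stage2 Y2 V2 z)%:R
                  - c3 * (stage3 z)%:R).

Lemma stage2_step e z M : 0 < omega -> 0 <= alpha -> adm z.1 -> adm z.2 ->
  z.1.1 <= M -> z.2.1 <= M -> 1 <= e ^+ 2 <= 2 ->
  stage2 (2 * (omega + alpha * M)) (omega + alpha * (2 * (omega + alpha * M)))
    (coupled_step z e).
Proof.
move=> o0 a0.
have aux (x : R * R) : adm x -> x.1 <= M -> 1 <= e ^+ 2 <= 2 ->
    [/\ omega <= (step x e).1, (step x e).1 <= 2 * (omega + alpha * M) &
     (step x e).2 <= omega + alpha * (2 * (omega + alpha * M))].
  move=> ax xM /andP[e1 e2]; have [x1 x2 x3] := ax.
  have vM : x.2 <= omega + alpha * M.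
    by apply: (le_trans x3); rewrite lerD2l ler_wpM2l.
  have y1 : omega <= x.2 * e ^+ 2.
    by apply: (le_trans x2); rewrite ler_peMr//; exact: le_trans (ltW o0) x2.
  have y2 : x.2 * e ^+ 2 <= 2 * (omega + alpha * M).
    rewrite mulrC; apply: ler_pM => //; first exact: sqr_ge0.
    exact: le_trans (ltW o0) x2.
  have [_ _ a3] := admissible_step k o0 a0 e ax.
  split => //; apply: le_trans a3 _; rewrite lerD2l ler_wpM2l//.
move=> a1 a2 z1 z2 e12.
have [h1 h2 h3] := aux _ a1 z1 e12; have [h4 h5 h6] := aux _ a2 z2 e12.
by apply/and5P; split => //; apply/andP.
Qed.

Lemma stage3_step e z Y2 V2 : 0 < omega -> 0 <= k -> 0 < V2 ->
  adm z.1 -> adm z.2 -> stage2 Y2 V2 z -> e ^+ 2 <= k * omega / V2 ->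
  stage3 (coupled_step z e).
Proof.
move=> o0 k0 V20.
have aux (x : R * R) : adm x -> omega <= x.1 -> x.2 <= V2 ->
    e ^+ 2 <= k * omega / V2 ->
    (step x e).2 = omega /\ (step x e).1 <= k * omega.
  move=> [_ x2 _] x1 xV ek; have x20 : 0 <= x.2 by exact: le_trans (ltW o0) x2.
  have y1 : x.2 * e ^+ 2 <= k * omega.
    apply: (@le_trans _ _ (V2 * (k * omega / V2))).
      by apply: ler_pM => //; exact: sqr_ge0.
    by rewrite mulrC divfK// gt_eqF.
  rewrite /tarch_step /=; split => //.
  suff -> : (k * x.1 < x.2 * e ^+ 2) = false by rewrite mulr0 addr0.
  by apply/negbTE; rewrite -leNgt (le_trans y1)// ler_wpM2l.
move=> a1 a2 /and5P[h1 _ h2 _ /andP[h3 h4]] ek.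
have [f1 g1] := aux _ a1 h1 h3 ek; have [f2 g2] := aux _ a2 h2 h4 ek.
by apply/and4P; split => //; exact/eqP.
Qed.

Lemma coalescence_step e z : 0 < omega -> 0 <= k ->
  stage3 z -> k ^+ 2 < e ^+ 2 -> ~~ apart (coupled_step z e).
Proof.
move=> o0 k0.
have aux (x : R * R) : x.2 = omega -> x.1 <= k * omega -> k ^+ 2 < e ^+ 2 ->
    step x e = (omega * e ^+ 2, omega + alpha * (omega * e ^+ 2)).
  move=> x2 x1 ke; rewrite /tarch_step x2.
  suff -> : (k * x.1 < omega * e ^+ 2) = true by rewrite mulr1.
  apply: (@le_lt_trans _ _ (k * (k * omega))); first by rewrite ler_wpM2l.
  by rewrite mulrA mulrC -expr2 ltr_pM2l.
move=> /and4P[/eqP h1 /eqP h2 h3 h4] ke.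
by rewrite /apart /coupled_step !aux//= !eqxx.
Qed.

Lemma apart_step e z : ~~ apart z -> ~~ apart (coupled_step z e).
Proof.
case: z => [[y v] [y' v']]; rewrite /apart /= negbK => /andP[/eqP-> /eqP->].
by rewrite !eqxx.
Qed.

Lemma measurable_coupling_fun d (T : measurableType d) (Z : T -> (R * R) * (R * R))
    theta c2 c3 Y2 V2 :
  measurable_fun setT Z ->
  measurable_fun setT (fun w => coupling_fun theta c2 c3 Y2 V2 (Z w)).
Proof.
move=> mZ.
have mZ1 : measurable_fun setT (fun w => (Z w).1) by exact: measurableT_comp.
have mZ2 : measurable_fun setT (fun w => (Z w).2) by exact: measurableT_comp.
have m11 : measurable_fun setT (fun w => (Z w).1.1) by exact: measurableT_comp.
have m12 : measurable_fun setT (fun w => (Z w).1.2) by exact: measurableT_comp.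
have m21 : measurable_fun setT (fun w => (Z w).2.1) by exact: measurableT_comp.
have m22 : measurable_fun setT (fun w => (Z w).2.2) by exact: measurableT_comp.
have mb (b : T -> bool) : measurable_fun setT b ->
    measurable_fun setT (fun w => (b w)%:R : R).
  by move=> ?; apply: (measurableT_comp (f := fun b : bool => b%:R : R)).
have mle (f g : T -> R) : measurable_fun setT f -> measurable_fun setT g ->
    measurable_fun setT (fun w => f w <= g w :> R).
  by move=> mf mg; exact: measurable_fun_ler.
have meq (f g : T -> R) : measurable_fun setT f -> measurable_fun setT g ->
    measurable_fun setT (fun w => f w == g w :> R).
  by move=> mf mg; exact: measurable_fun_eqr.
apply: measurable_funM.
  apply: mb; apply: measurable_neg; apply: measurable_and; exact: meq.
apply: measurable_funB; last first.
  apply: measurable_funM => //; apply: mb.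
  by do ! [apply: measurable_and; [by apply: mle || by apply: meq|]]; apply: mle.
apply: measurable_funB; last first.
  apply: measurable_funM => //; apply: mb.
  by do ! [apply: measurable_and; [by apply: mle || by apply: meq|]]; apply: mle.
apply: measurable_funD => //; apply: measurable_funM => //.
by apply: measurable_funD; exact: measurable_lyap.
Qed.

End coupling.

Lemma measurable_event (R : realType) (b : R -> bool) :
  measurable_fun (setT : set (measurableTypeR R)) b ->
  measurable ([set e | b e] : set (measurableTypeR R)).
Proof.
move=> mb; rewrite (_ : [set e | b e] = b @^-1` [set true]).
  by rewrite -[X in measurable X]setTI; exact: mb.
by apply/seteqP; split=> e /=.
Qed.

(** * One-step estimates for the coupled chain *)

Section coupling_drift.
Context {R : realType}.
Variables (omega alpha k : R) (p : nat) (nu : probability (measurableTypeR R) R).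
Variables (lam rho C : R).
Local Notation step := (tarch_step omega alpha k).
Local Notation adm := (admissible omega alpha).
Local Notation V := (lyap p lam).
Local Notation cstep := (coupled_step omega alpha k).
Local Notation W := (coupling_fun omega k p lam).

Hypotheses (omega0 : 0 < omega) (alpha0 : 0 <= alpha) (lam0 : 0 < lam).
Hypothesis drift : forall x, adm x ->
  (\int[nu]_e (V (step x e))%:E <= (rho * V x + C)%:E)%E.

Let measurable_cstep z :
  measurable_fun (setT : set (measurableTypeR R)) (cstep z).
Proof. by apply: measurable_fun_pair => /=; exact: measurable_tarch_step. Qed.

Let VV_drift z : adm z.1 -> adm z.2 ->
  (\int[nu]_e (V (step z.1 e) + V (step z.2 e))%:E <=
    (rho * (V z.1 + V z.2) + 2 * C)%:E)%E.
Proof.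
move=> a1 a2.
under eq_integral do rewrite EFinD.
have m x : measurable_fun (setT : set (measurableTypeR R)) (fun e => (V (step x e))%:E).
  by apply/measurable_EFinP; apply: measurable_lyap; exact: measurable_tarch_step.
have n x : adm x -> forall e, (0 <= (V (step x e))%:E)%E.
  move=> ax e; rewrite lee_fin; apply: (lyap_ge0 omega0 p (ltW lam0)).
  exact: admissible_step.
rewrite ge0_integralD//; [|by move=> e _; exact: n..].
apply: le_trans (leeD (drift a1) (drift a2)) _.
by rewrite -EFinD lee_fin; lra.
Qed.

(** If on the event [b] the next value of [W] lies at least [c] below its ceiling
    [1 + theta * (V + V)], the expectation gains [c] times the probability of [b]. Each transition
    between stages is one instance. *)
Lemma integral_with_bonus z (theta c2 c3 Y2 V2 c delta : R) (b : R -> bool) :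
  adm z.1 -> adm z.2 -> 0 <= theta -> 0 <= c ->
  measurable_fun (setT : set (measurableTypeR R)) b ->
  (delta%:E <= nu [set e | b e])%E ->
  (forall e, 0 <= W theta c2 c3 Y2 V2 (cstep z e)) ->
  (forall e, W theta c2 c3 Y2 V2 (cstep z e) + c * (b e)%:R <=
    1 + theta * (V (step z.1 e) + V (step z.2 e))) ->
  (\int[nu]_e (W theta c2 c3 Y2 V2 (cstep z e))%:E <=
    (1 + theta * (rho * (V z.1 + V z.2) + 2 * C) - c * delta)%:E)%E.
Proof.
move=> a1 a2 t0 c0 mb db W0 Wle.
set w := fun e => W theta c2 c3 Y2 V2 (cstep z e) in W0 Wle *.
have mw : measurable_fun (setT : set (measurableTypeR R)) (fun e => (w e)%:E).
  by apply/measurable_EFinP; apply: measurable_coupling_fun; exact: measurable_cstep.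
have mbR : measurable_fun (setT : set (measurableTypeR R)) (fun e => (b e)%:R : R).
  by apply: (measurableT_comp (f := fun b : bool => b%:R : R)).
have mV x : measurable_fun (setT : set (measurableTypeR R)) (fun e => V (step x e)).
  by apply: measurable_lyap; exact: measurable_tarch_step.
have V0 x : adm x -> forall e, 0 <= V (step x e).
  move=> ax e; apply: (lyap_ge0 omega0 p (ltW lam0)).
  exact: admissible_step.
have bint : (\int[nu]_e (c * (b e)%:R)%:E = c%:E * nu [set e | b e])%E.
  under eq_integral do rewrite EFinM.
  rewrite ge0_integralZl//; [|exact/measurable_EFinP].
  congr (_ * _)%E; rewrite -[in RHS](setIT [set e | b e]) -integral_indic//.
    by apply: eq_integral => e _; rewrite indicE mem_setE.
  exact: measurable_event.
rewrite EFinB leeBrDr//.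
apply: (@le_trans _ _ (\int[nu]_e (w e)%:E + \int[nu]_e (c * (b e)%:R)%:E)%E).
  by rewrite leeD2l// bint EFinM lee_wpmul2l.
rewrite -ge0_integralD//; last 3 first.
- by move=> e _; rewrite lee_fin; exact: W0.
- by move=> e _; rewrite lee_fin mulr_ge0.
- by apply/measurable_EFinP; exact: measurable_funM.
apply: (@le_trans _ _ (\int[nu]_e
   (1 + theta%:E * (V (step z.1 e) + V (step z.2 e))%:E))%E).
  apply: ge0_le_integral => //.
  - by move=> e _; rewrite -EFinD lee_fin; apply: addr_ge0; [exact: W0|exact: mulr_ge0].
  - by apply: emeasurable_funD => //; apply/measurable_EFinP; exact: measurable_funM.
  - apply: emeasurable_funD => //; apply: measurable_funeM.
    by apply/measurable_EFinP; exact: measurable_funD.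
  - by move=> e _; rewrite -EFinM -!EFinD lee_fin; exact: Wle.
rewrite ge0_integralD//; last 2 first.
- by move=> e _; rewrite -EFinM lee_fin mulr_ge0// addr_ge0 ?V0.
- by apply: measurable_funeM; apply/measurable_EFinP; exact: measurable_funD.
rewrite integral_cst//= probability_setT mul1e ge0_integralZl//; last 2 first.
- by apply/measurable_EFinP; exact: measurable_funD.
- by move=> e _; rewrite lee_fin addr_ge0 ?V0.
rewrite EFinD leeD2l// EFinM lee_wpmul2l//; exact: VV_drift.
Qed.

End coupling_drift.

(** Far out the drift alone contracts. In the bounded region [theta] makes the Lyapunov part
    negligible, and the expected bonus for reaching the next stage exceeds the bonus held in the
    present one. *)
Lemma coupling_contraction (R : realType) (omega alpha k : R) (p : nat)
    (nu : probability (measurableTypeR R) R) (lam rho C : R) :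
  0 < omega -> 0 <= alpha -> 0 < k -> (1 <= p)%N ->
  0 < lam -> 0 <= rho -> rho < 1 -> 0 <= C ->
  (forall x, admissible omega alpha x ->
    (\int[nu]_e (lyap p lam (tarch_step omega alpha k x e))%:E <=
      (rho * lyap p lam x + C)%:E)%E) ->
  (0 < nu [set e | (1 <= e ^+ 2 <= 2)%R])%E ->
  (forall c : R, 0 < c -> (0 < nu [set e | (e ^+ 2 <= c)%R])%E) ->
  (forall c : R, 0 <= c -> (0 < nu [set e | (c < e ^+ 2)%R])%E) ->
  exists theta c2 c3 Y2 V2 r : R,
  [/\ 0 <= theta, 0 <= r < 1,
   forall z, admissible omega alpha z.1 -> admissible omega alpha z.2 ->
    (apart z)%:R / 4 <= coupling_fun omega k p lam theta c2 c3 Y2 V2 z,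
   forall z, admissible omega alpha z.1 -> admissible omega alpha z.2 ->
     coupling_fun omega k p lam theta c2 c3 Y2 V2 z <=
       1 + theta * (lyap p lam z.1 + lyap p lam z.2) &
   forall z, admissible omega alpha z.1 -> admissible omega alpha z.2 ->
     (\int[nu]_e (coupling_fun omega k p lam theta c2 c3 Y2 V2
       (coupled_step omega alpha k z e))%:E <=
       (r * coupling_fun omega k p lam theta c2 c3 Y2 V2 z)%:E)%E].
Proof.
move=> o0 a0 kk0 p1 l0 r0 r1 CC0 drift nu12 nu_small nu_large.
(* Once the total Lyapunov value [G] exceeds [M], [4 * C <= (1 - rho) * G], so the drift bound is at
   most [(1 + rho) / 2] times [G]. *)
pose M : R := 4 * C / (1 - rho) + 1.
have M0 : 0 < M by rewrite ltr_pwDr// divr_ge0; lra.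
pose M1 : R := M + 1.
pose Y2 : R := 2 * (omega + alpha * M1).
pose V2 : R := omega + alpha * Y2.
have aM1 : 0 <= alpha * M1 by rewrite mulr_ge0// /M1; lra.
have Y20 : 0 <= Y2 by rewrite /Y2; lra.
have V20 : 0 < V2 by rewrite /V2; have := mulr_ge0 a0 Y20; lra.
have getd (b : R -> bool) : measurable_fun (setT : set (measurableTypeR R)) b ->
    (0 < nu [set e | b e])%E ->
    exists delta : R, [/\ 0 < delta, delta <= 1 & (delta%:E <= nu [set e | b e])%E].
  move=> mb b0; exists (fine (nu [set e | b e])).
  have mE := measurable_event mb.
  have fE : nu [set e | b e] \is a fin_num by rewrite fin_num_measure.
  split; last by rewrite fineK.
  - by rewrite fine_gt0// b0 ltey_eq fE.
  - by rewrite -lee_fin fineK// probability_le1.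
pose b1 (e : R) := 1 <= e ^+ 2 <= 2.
pose b2 (e : R) := e ^+ 2 <= k * omega / V2.
pose b3 (e : R) := k ^+ 2 < e ^+ 2.
have mb1 : measurable_fun (setT : set (measurableTypeR R)) b1.
  by apply: measurable_and; apply: measurable_fun_ler.
have mb2 : measurable_fun (setT : set (measurableTypeR R)) b2 by apply: measurable_fun_ler.
have mb3 : measurable_fun (setT : set (measurableTypeR R)) b3 by apply: measurable_fun_ltr.
have [d1 [d10 d11 d1E]] := getd _ mb1 nu12.
have kV : 0 < k * omega / V2 by rewrite divr_gt0// mulr_gt0.
have [d2 [d20 d21 d2E]] := getd _ mb2 (nu_small _ kV).
have [d3 [d30 d31 d3E]] := getd _ mb3 (nu_large _ (sqr_ge0 k)).
(* Expected gains are twice the bonus of the stage being left: [d3 = 2 * c3] from the third stage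
   and [c3 * d2 = 2 * c2] from the second. *)
pose c3 : R := d3 / 2.
pose c2 : R := c3 * d2 / 2.
have c30 : 0 < c3 by rewrite /c3; lra.
have c31 : c3 <= 2^-1 by rewrite /c3; lra.
have c20 : 0 < c2 by rewrite /c2 divr_gt0 ?mulr_gt0.
have c2c3 : c2 <= c3 / 2 by rewrite /c2; nra.
pose eta : R := c2 * d1.
have eta0 : 0 < eta by rewrite mulr_gt0.
have etac2 : eta <= c2 by rewrite /eta ler_piMr// ltW.
(* [M'] bounds the total Lyapunov value in the second stage, in the third stage, and wherever it is
   at most [M]. *)
pose M' : R := M + 2 * (Y2 ^+ p + lam * V2 ^+ p) +
  2 * ((k * omega) ^+ p + lam * omega ^+ p).
have ko0 : 0 <= k * omega by rewrite mulr_ge0 ?ltW.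
have lp (x y : R) : 0 <= x -> 0 <= y -> 0 <= x ^+ p + lam * y ^+ p.
  by move=> x0 y0; rewrite addr_ge0 ?exprn_ge0// mulr_ge0 ?exprn_ge0// ltW.
have lp1 := lp _ _ Y20 (ltW V20); have lp2 := lp _ _ ko0 (ltW o0).
have M'0 : 0 < M' by rewrite /M'; lra.
pose K : R := M' + 2 * C.
have K0 : 0 < K by rewrite /K; lra.
(* With this weight the Lyapunov part after one step from the bounded region costs at most half of
   [eta], the smallest expected gain. *)
pose theta : R := eta / (2 * K).
have theta0 : 0 < theta by rewrite divr_gt0// mulr_gt0.
have thetaK : theta * K = eta / 2 by rewrite /theta; field; exact: lt0r_neq0.
pose a : R := (1 + rho) / 2.
(* The first bound fits the margin [eta / 2] of the bounded region; the second makes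
   [1 + theta * a * G] at most [(1 - zeta) * (1 + theta * G)] for every [G] above [M]. *)
pose zeta : R := Num.min (eta / 2) (theta * M * (1 - a) / (1 + theta * M)).
have tM0 : 0 < theta * M by rewrite mulr_gt0.
have a1 : 0 < 1 - a by rewrite /a; lra.
have zeta0 : 0 < zeta.
  rewrite lt_min; apply/andP; split; first exact: divr_gt0.
  by apply: divr_gt0; [exact: mulr_gt0|lra].
have zeta1 : zeta <= eta / 2 by rewrite ge_min lexx.
have zeta2 : zeta * (1 + theta * M) <= theta * M * (1 - a).
  by rewrite -ler_pdivlMr ?ge_min ?lexx ?orbT//; lra.
have eta1 : eta <= 1 by apply: le_trans etac2 _; rewrite /c3 in c2c3; lra.
exists theta, c2, c3, Y2, V2, (1 - zeta).
have V0 x : admissible omega alpha x -> 0 <= lyap p lam x.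
  by move=> ax; apply: (lyap_ge0 o0 p (ltW l0) ax).
have Wpos z : admissible omega alpha z.1 -> admissible omega alpha z.2 ->
    (apart z)%:R / 4 <= coupling_fun omega k p lam theta c2 c3 Y2 V2 z.
  move=> z1 z2; rewrite /coupling_fun.
  have g0 : 0 <= theta * (lyap p lam z.1 + lyap p lam z.2).
    exact: (mulr_ge0 (ltW theta0) (addr_ge0 (V0 _ z1) (V0 _ z2))).
  move: c2c3 c30 c20 c31 g0; clear => *.
  case: (apart z); rewrite ?mul0r ?mul1r//.
  by case: (stage2 _ _ _ _); case: (stage3 _ _ _); rewrite ?mulr1 ?mulr0; lra.
have Wle z : admissible omega alpha z.1 -> admissible omega alpha z.2 ->
    coupling_fun omega k p lam theta c2 c3 Y2 V2 z <= 1 + theta * (lyap p lam z.1 + lyap p lam z.2).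
  move=> z1 z2; rewrite /coupling_fun.
  have g0 : 0 <= theta * (lyap p lam z.1 + lyap p lam z.2).
    exact: (mulr_ge0 (ltW theta0) (addr_ge0 (V0 _ z1) (V0 _ z2))).
  move: c30 c20 g0; clear => *.
  case: (apart z); rewrite ?mul0r ?mul1r//; last by lra.
  by case: (stage2 _ _ _ _); case: (stage3 _ _ _); rewrite ?mulr1 ?mulr0; lra.
split => //; [exact: ltW|by lra|].
move=> z z1 z2.
have adm1 e : admissible omega alpha (tarch_step omega alpha k z.1 e) by exact: admissible_step.
have adm2 e : admissible omega alpha (tarch_step omega alpha k z.2 e) by exact: admissible_step.
have W0 e : 0 <= coupling_fun omega k p lam theta c2 c3 Y2 V2 (coupled_step omega alpha k z e).
  by apply: (le_trans _ (Wpos (coupled_step omega alpha k z e) (adm1 e) (adm2 e)));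
    rewrite divr_ge0.
have Wlee e : coupling_fun omega k p lam theta c2 c3 Y2 V2 (coupled_step omega alpha k z e) <=
    1 + theta * (lyap p lam (tarch_step omega alpha k z.1 e) +
      lyap p lam (tarch_step omega alpha k z.2 e)) :=
  Wle (coupled_step omega alpha k z e) (adm1 e) (adm2 e).
have g0 : 0 <= theta * (lyap p lam z.1 + lyap p lam z.2).
  exact: (mulr_ge0 (ltW theta0) (addr_ge0 (V0 _ z1) (V0 _ z2))).
have g0e e : 0 <= theta * (lyap p lam (tarch_step omega alpha k z.1 e) +
    lyap p lam (tarch_step omega alpha k z.2 e)).
  exact: (mulr_ge0 (ltW theta0) (addr_ge0 (V0 _ (adm1 e)) (V0 _ (adm2 e)))).
have [az|naz] := boolP (apart z); last first.
  rewrite integral0_eq ?lee_fin.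
    apply: mulr_ge0; first by lra.
    by apply: (le_trans _ (Wpos z z1 z2)); rewrite divr_ge0.
  move=> e _; rewrite /coupling_fun.
  by rewrite (negbTE (apart_step omega alpha k e naz)) mul0r.
have Wz : coupling_fun omega k p lam theta c2 c3 Y2 V2 z =
  1 + theta * (lyap p lam z.1 + lyap p lam z.2) -
  c2 * (stage2 omega Y2 V2 z)%:R - c3 * (stage3 omega k z)%:R.
  by rewrite /coupling_fun az mul1r.
have bound := @integral_with_bonus R omega alpha k p nu lam rho C o0 a0 l0 drift z
  theta c2 c3 Y2 V2.
pose G := lyap p lam z.1 + lyap p lam z.2.
rewrite -/G in Wz g0.
have G0 : 0 <= G by exact: addr_ge0 (V0 _ z1) (V0 _ z2).
have smallG : G <= M' -> theta * (rho * G + 2 * C) <= eta / 2.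
  move=> GM'; rewrite -thetaK ler_pM2l// /K lerD2r; apply: le_trans GM'.
  by rewrite ler_piMl// ltW.
(* The target in the bounded cases, [c] being the bonus currently held. *)
have low (c : R) : 0 <= c -> 1 - c - eta / 2 <= (1 - zeta) * (1 + theta * G - c).
  move=> c0; have h1 := mulr_ge0 (ltW zeta0) c0.
  have zeta_le1 : 0 <= 1 - zeta by move: zeta1 eta1; clear; lra.
  have h2 := mulr_ge0 zeta_le1 g0.
  by move: h1 h2 zeta1; clear; lra.
have V_le x Y v : admissible omega alpha x -> x.1 <= Y -> x.2 <= v ->
    lyap p lam x <= Y ^+ p + lam * v ^+ p.
  move=> [x1 x2 _] xY xv; have x20 : 0 <= x.2 by exact: le_trans (ltW o0) x2.
  rewrite /lyap lerD//; first by rewrite lerXn2r ?nnegrE//; exact: le_trans xY.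
  by rewrite ler_pM2l// lerXn2r ?nnegrE//; exact: le_trans xv.
have [S3|nS3] := boolP (stage3 omega k z).
  have GM' : G <= M'.
    have /and4P[/eqP h1 /eqP h2 h3 h4] := S3.
    have v1 := V_le _ _ omega z1 h3; have v2 := V_le _ _ omega z2 h4.
    by rewrite h1 h2 !lexx in v1 v2; move: (v1 isT) (v2 isT) lp1 M0; rewrite /G /M'; clear; lra.
  apply: le_trans (bound 1 d3 b3 z1 z2 (ltW theta0) ler01 mb3 d3E W0 _) _.
    move=> e; case: (boolP (b3 e)) => be; last by rewrite mulr0 addr0.
    have := coalescence_step alpha o0 (ltW kk0) S3 be.
    rewrite /coupling_fun => /negbTE ->; rewrite mul0r add0r mul1r/=.
    by rewrite lerDl g0e.
  rewrite lee_fin Wz S3 mulr1 mul1r -/G.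
  have c20' : 0 <= c2 * (stage2 omega Y2 V2 z)%:R by rewrite mulr_ge0// ltW.
  have c2le : c2 * (stage2 omega Y2 V2 z)%:R <= c2.
    by rewrite ler_piMr ?(ltW c20)//; case: (stage2 _ _ _ _).
  have := low (c2 * (stage2 omega Y2 V2 z)%:R + c3) (addr_ge0 c20' (ltW c30)).
  rewrite opprD addrA [1 + theta * G + _]addrA => low3.
  have d3E' : d3 = 2 * c3 by rewrite /c3; field.
  by move: low3 (smallG GM') c2c3 c2le etac2 d3E'; clear; lra.
have [S2|nS2] := boolP (stage2 omega Y2 V2 z).
  have GM' : G <= M'.
    have /and5P[_ h1 _ h2 /andP[h3 h4]] := S2.
    have v1 := V_le _ _ _ z1 h1 h3; have v2 := V_le _ _ _ z2 h2 h4.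
    by move: v1 v2 lp2 M0; rewrite /G /M'; clear; lra.
  apply: le_trans (bound c3 d2 b2 z1 z2 (ltW theta0) (ltW c30) mb2 d2E W0 _) _.
    move=> e; case: (boolP (b2 e)) => be; last by rewrite mulr0 addr0.
    have S3' := stage3_step o0 (ltW kk0) V20 z1 z2 S2 be.
    rewrite /coupling_fun S3' !mulr1/=.
    have ge := g0e e.
    have c2s : 0 <= c2 * (stage2 omega Y2 V2 (coupled_step omega alpha k z e))%:R.
      by rewrite mulr_ge0// ltW.
    move: ge c2s c31; clear => *.
    by case: (apart _) => /=; rewrite ?mul1r ?mul0r; lra.
  rewrite lee_fin Wz S2 (negbTE nS3) mulr0 subr0 mulr1 -/G.
  have c3d2 : c3 * d2 = 2 * c2 by rewrite /c2; field.
  by move: (low c2 (ltW c20)) (smallG GM') c3d2 etac2; clear; lra.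
rewrite Wz (negbTE nS2) (negbTE nS3) !mulr0 !subr0.
have [GM|GM] := leP G M.
  have GM' : G <= M' by move: GM lp1 lp2; rewrite /M'; clear; lra.
  have xM x : admissible omega alpha x -> lyap p lam x <= M -> x.1 <= M1.
    move=> [x1 x2 _] Vx; rewrite leNgt; apply/negP => M1x.
    move: Vx; rewrite leNgt => /negP; apply.
    apply: (@lt_le_trans _ _ x.1); first by move: M1x; rewrite /M1; clear; lra.
    apply: (@le_trans _ _ (x.1 ^+ p)).
      rewrite -[leLHS]expr1 ler_weXn2l//.
      by move: M1x M0; rewrite /M1; clear; lra.
    by rewrite lerDl mulr_ge0 ?(ltW l0) ?exprn_ge0//; exact: le_trans (ltW o0) x2.
  have [zM1 zM2] : z.1.1 <= M1 /\ z.2.1 <= M1.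
    split; apply: xM => //; apply: le_trans GM; rewrite /G.
      by rewrite lerDl V0.
    by rewrite lerDr V0.
  apply: le_trans (bound c2 d1 b1 z1 z2 (ltW theta0) (ltW c20) mb1 d1E W0 _) _.
    move=> e; case: (boolP (b1 e)) => be; last by rewrite mulr0 addr0.
    have S2' := stage2_step k o0 a0 z1 z2 zM1 zM2 be.
    rewrite /coupling_fun S2' !mulr1/=.
    have ge := g0e e.
    have c3s : 0 <= c3 * (stage3 omega k (coupled_step omega alpha k z e))%:R.
      by rewrite mulr_ge0// ltW.
    move: ge c3s c31 c2c3; clear => *.
    by case: (apart _) => /=; rewrite ?mul1r ?mul0r; lra.
  rewrite lee_fin -/G -/eta.
  have := low 0 (lexx 0); rewrite !subr0.
  by move: (smallG GM'); clear; lra.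
(* Here [G] exceeds [M]: the drift suffices, so the bonus is 0 on an empty event. *)
apply: le_trans (bound 0 0 (fun=> false) z1 z2 (ltW theta0) (lexx 0) _ _ W0 _) _ => //.
- by move=> e; rewrite mul0r addr0.
rewrite lee_fin mul0r subr0 -/G.
have C4 : 4 * C <= (1 - rho) * G.
  have : 4 * C / (1 - rho) <= G by move: GM; rewrite /M; clear; lra.
  by rewrite ler_pdivrMr ?[_ * G]mulrC//; move: r1; clear; lra.
have z1a : 0 < 1 - a - zeta.
  have h : 0 < theta * M * (1 - a - zeta).
    by move: zeta2 zeta0; clear; lra.
  by move: h; rewrite pmulr_rgt0.
have h1 : 0 <= theta * (G - M) * (1 - a - zeta).
  have GM0 : 0 <= G - M by rewrite subr_ge0 ltW.
  exact: mulr_ge0 (mulr_ge0 (ltW theta0) GM0) (ltW z1a).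
have h2 : theta * (rho * G + 2 * C) <= theta * (a * G).
  by rewrite ler_pM2l// /a; move: C4; clear; lra.
by move: h1 h2 zeta2; clear; lra.
Qed.

(** * Past, present and shift of an i.i.d. sequence *)

(** A positive density with zero integral over a set forces that set to be Lebesgue-null. *)
Lemma square_density_gt0 (R : realType) (nu : probability (measurableTypeR R) R)
    (f : R -> R) (A : set R) :
  square_density nu f -> (forall y, 0 <= y -> 0 < f y) -> measurable A ->
  (0 < lebesgue_measure (A `&` `[0%R, +oo[%classic))%E ->
  (0 < nu ((fun x => (x ^+ 2)%R) @^-1` A))%E.
Proof.
move=> [mf nuE] f0 mA A0; rewrite nuE//.
set D := A `&` _ in A0 *.
have mD : measurable D by exact: measurableI.
have mfD : measurable_fun D (EFin \o f).
  by apply/measurable_EFinP; apply: measurable_funS mf => // x [].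
have fD x : D x -> (0 <= (f x)%:E)%E.
  by move=> [_]; rewrite /= in_itv/= andbT => x0; rewrite lee_fin ltW// f0.
rewrite lt0e integral_ge0 ?andbT//; apply/eqP => int0.
have /(ae_eq_integral_abs lebesgue_measure mD mfD) :
    (\int[lebesgue_measure]_(x in D) `|(EFin \o f) x| = 0)%E.
  rewrite -int0; apply: eq_integral => x; rewrite inE => Dx.
  by rewrite gee0_abs//; exact: fD.
case=> N [mN N0 DN]; move: A0; rewrite ltNge => /negP; apply.
rewrite -N0; apply: le_measure; rewrite ?inE//.
apply: subset_trans DN => x Dx /= /(_ Dx) [] fx0.
by move: Dx => [_]; rewrite /= in_itv/= andbT => /f0; rewrite fx0 ltxx.
Qed.

Section sequence_shift.
Context {R : realType}.
Local Notation RT := (measurableTypeR R).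
Local Notation space := (seqspace int RT).
Variables (nu : probability RT R) (P : probability space R).
Hypothesis iP : iid_family P nu (fun t w => w t).

Definition shift (h : int) (w : space) : space := fun t => w (t + h).

(** The shifted coordinates form an i.i.d. family with the same law, so uniqueness applies. *)
Lemma shift_invariant h (A : set space) : measurable A ->
  P (shift h @^-1` A) = P A.
Proof.
move=> mA.
have addK : cancel (fun t : int => t + h) (fun t => t - h) by move=> t; rewrite addrK.
have mc (t : int) : measurable_fun setT (fun w : space => w (t + h)).
  exact: measurable_coord.
have [Q [iQ QE]] := iid_law mc (iid_reindex addK iP).
by rewrite -(iid_family_unique iQ iP mA) QE.
Qed.

Lemma coord_law (t : int) (B : set RT) : measurable B ->
  P ((fun w : space => w t) @^-1` B) = nu B.
Proof.
move=> mB; have := iP (s := [:: t]) (B := fun=> B) isT (fun=> mB).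
rewrite big_seq1 => <-; congr (P _); apply/seteqP; split=> w /=.
  by move=> Bw i; rewrite inE => /eqP->.
by apply; rewrite inE.
Qed.

Lemma indep_past_present (t : int) (A : set space) (B : set RT) :
  measurable A -> measurable B ->
  restrict_coords (fun s => s < t) @^-1` A = A ->
  P (A `&` (fun w : space => w t) @^-1` B) =
  (P A * P ((fun w : space => w t) @^-1` B))%E.
Proof.
move=> mA mB rA.
have mC : measurable ((fun w : space => w t) @^-1` B).
  by rewrite -[X in measurable X]setTI; exact: measurable_coord.
have rC : restrict_coords (predC (fun s => s < t)) @^-1`
    ((fun w : space => w t) @^-1` B) = (fun w : space => w t) @^-1` B.
  by apply/seteqP; split=> w /=; rewrite /restrict_coords /= ltxx.
by have := iid_indep_restrict (fun s => s < t) iP mA mC; rewrite rA rC.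
Qed.

(** By independence the joint law of [X] and the present innovation is a product measure, and
    Tonelli applies. *)
Let integral_past_present0 d (S : measurableType d) (t : int) (X : space -> S)
    (h : S * RT -> \bar R) :
  measurable_fun setT X ->
  (forall w, X (restrict_coords (fun s => s < t) w) = X w) ->
  measurable_fun setT h -> (forall x, 0 <= h x)%E ->
  (\int[P]_w h (X w, w t) = \int[P]_w \int[nu]_e h (X w, e))%E.
Proof.
move=> mX rX mh h0.
pose Xm : {RV P >-> S} := HB.pack X (isMeasurableFun.Build _ _ _ _ _ mX).
have mZ : measurable_fun setT (fun w : space => (X w, w t)).
  by apply: measurable_fun_pair => //; exact: measurable_coord.
pose Zm : {RV P >-> (S * RT)%type} := HB.pack (fun w : space => (X w, w t))
  (isMeasurableFun.Build _ _ _ _ _ mZ).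
transitivity (\int[distribution P Zm]_z h z)%E.
  by rewrite ge0_integral_distribution.
transitivity (\int[(distribution P Xm \x nu)%E]_z h z)%E.
  apply: eq_measure_integral => /= A mA _; apply/esym.
  apply: product_measure_unique => // B C mB mC.
  have mXB : measurable (X @^-1` B) by rewrite -[X in measurable X]setTI; exact: (mX).
  have := @indep_past_present t (X @^-1` B) C mXB mC.
  rewrite (coord_law t mC) => <-//.
  by apply/seteqP; split=> w /=; rewrite rX.
rewrite fubini_tonelli1//.
rewrite ge0_integral_distribution//.
  exact: measurable_fun_fubini_tonelli_F.
by move=> x; apply: integral_ge0.
Qed.

(** The Lyapunov and coupling integrands are known to be nonnegative only at admissible states,
    hence the hypothesis on the range of [X]; passing to the positive part changes nothing there. *)
Lemma integral_past_present d (S : measurableType d) (t : int) (X : space -> S)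
    (h : S * RT -> \bar R) :
  measurable_fun setT X ->
  (forall w, X (restrict_coords (fun s => s < t) w) = X w) ->
  measurable_fun setT h -> (forall w e, 0 <= h (X w, e))%E ->
  (\int[P]_w h (X w, w t) = \int[P]_w \int[nu]_e h (X w, e))%E.
Proof.
move=> mX rX mh h0.
have m0 : measurable_fun setT (fun z => maxe (h z) 0%E) by exact: measurable_maxe.
have hmax w e : maxe (h (X w, e)) 0%E = h (X w, e) by apply/max_idPl.
transitivity (\int[P]_w maxe (h (X w, w t)) 0)%E.
  by apply: eq_integral => w _; rewrite hmax.
rewrite (integral_past_present0 mX rX m0) => [|x]; last by rewrite le_max lexx orbT.
by apply: eq_integral => w _; apply: eq_integral => e _; exact: hmax.
Qed.

Lemma measurable_integral_present d (S : measurableType d) (X : space -> S)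
    (h : S * RT -> \bar R) :
  measurable_fun setT X -> measurable_fun setT h ->
  (forall w e, 0 <= h (X w, e))%E ->
  measurable_fun setT (fun w => \int[nu]_e h (X w, e))%E.
Proof.
move=> mX mh h0.
have m0 : measurable_fun setT (fun z => maxe (h z) 0%E) by exact: measurable_maxe.
have hmax w e : maxe (h (X w, e)) 0%E = h (X w, e) by apply/max_idPl.
rewrite (_ : (fun w => _) = (fun x => \int[nu]_e maxe (h (x, e)) 0)%E \o X).
  apply: measurableT_comp => //.
  have hp z : (0 <= maxe (h z) 0)%E by rewrite le_max lexx orbT.
  exact: (@measurable_fun_fubini_tonelli_F _ _ _ _ _ nu _ m0 hp).
by apply/funext => w /=; apply: eq_integral => e _; rewrite hmax.
Qed.

End sequence_shift.

(** * Approximation by finitely many innovations *)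

Lemma measurable_fun_limn_einf d (T : measurableType d) (R : realType)
    (f : (T -> \bar R)^nat) : (forall n, measurable_fun setT (f n)) ->
  measurable_fun setT (fun x => limn_einf (f^~ x)).
Proof.
move=> mf; rewrite (_ : (fun x => _) = fun x => (- limn_esup (fun n => - f n x))%E).
  apply: measurableT_comp => //; apply: measurable_fun_limn_esup => n.
  exact: measurableT_comp.
apply/funext => x; rewrite -[RHS]limn_einfN; congr limn_einf.
by apply/funext => n /=; rewrite oppeK.
Qed.

Section approximation.
Context {R : realType}.
Local Notation RT := (measurableTypeR R).
Local Notation space := (seqspace int RT).
Variables (omega alpha k : R) (p : nat) (nu : probability RT R) (P : probability space R).
Hypothesis iP : iid_family P nu (fun t w => w t).
Hypotheses (omega0 : 0 < omega) (alpha0 : 0 <= alpha).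
Local Notation step := (tarch_step omega alpha k).
Local Notation adm := (admissible omega alpha).

(* The n-step chain ending at time t, started at time t - n from (0, omega). *)
Fixpoint state (n : nat) (t : int) (w : space) : R * R :=
  if n is m.+1 then step (state m (t - 1) w) (w t) else (0, omega).

Lemma state_admissible n t w : adm (state n t w).
Proof.
elim: n t => [|n IH] t /=; first exact: admissible_init.
exact: admissible_step.
Qed.

Lemma measurable_state n t : measurable_fun setT (state n t).
Proof.
elim: n t => [|n IH] t /=; first exact: measurable_cst.
by apply: measurable_tarch_step => //; exact: measurable_coord.
Qed.

Lemma state_shift n t h w : state n t (shift h w) = state n (t + h) w.
Proof.
elim: n t => [//|n IH] t /=; rewrite IH /shift.
by rewrite addrAC.
Qed.

Lemma state_restrict n t (u : int) w : t < u ->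
  state n t (restrict_coords (fun s => s < u) w) = state n t w.
Proof.
elim: n t => [//|n IH] t tu /=; rewrite IH; last first.
  by apply: lt_trans tu; rewrite ltrBlDr ltrDl.
by rewrite /restrict_coords tu.
Qed.

(** The upper limit is defined at every point, so measurability, compatibility with shifts and
    dependence on the past hold without exceptional sets. *)
Definition volatility (t : int) (w : space) : R :=
  fine (limn_esup (fun n => (state n t w).2%:E)).

Lemma measurable_volatility t : measurable_fun setT (volatility t).
Proof.
apply: (measurableT_comp (f := fine)) => //.
apply: measurable_fun_limn_esup => n; apply/measurable_EFinP.
by apply: measurableT_comp => //; exact: measurable_state.
Qed.

Lemma volatility_shift t h w : volatility t (shift h w) = volatility (t + h) w.
Proof.
by rewrite /volatility; under [in LHS]eq_fun do rewrite state_shift.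
Qed.

Lemma volatility_restrict t (u : int) w : t < u ->
  volatility t (restrict_coords (fun s => s < u) w) = volatility t w.
Proof.
by move=> tu; rewrite /volatility; under [in LHS]eq_fun do rewrite state_restrict//.
Qed.

Lemma volatilityE t w (l : R) : (state n t w).2 @[n --> \oo] --> l ->
  volatility t w = l.
Proof.
move=> vl; rewrite /volatility.
have vlE : (state n t w).2%:E @[n --> \oo] --> l%:E.
  by apply/cvg_EFin; [exact: nearW|exact: vl].
by rewrite is_cvg_limn_esupE; [rewrite (cvg_lim _ vlE)|apply: cvgP vlE].
Qed.

Variables (lam rho C : R).
Hypotheses (lam0 : 0 < lam) (rho0 : 0 <= rho) (rho1 : rho < 1) (C0 : 0 <= C).
Hypothesis drift : forall x, adm x ->
  (\int[nu]_e (lyap p lam (step x e))%:E <= (rho * lyap p lam x + C)%:E)%E.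

(** The constant, the initial value plus [C / (1 - rho)], satisfies [rho * K + C <= K], so it is
    preserved when the drift is averaged over the past. *)
Lemma state_lyap_bound : exists2 K : R, 0 <= K &
  forall n t, (\int[P]_w (lyap p lam (state n t w))%:E <= K%:E)%E.
Proof.
pose K : R := lyap p lam (0, omega) + C / (1 - rho).
have K1 : 0 <= lyap p lam (0, omega).
  exact: (lyap_ge0 omega0 p (ltW lam0) (admissible_init _ _)).
have r1 := rho1; have K2 : 0 <= C / (1 - rho) by rewrite divr_ge0//; lra.
exists K; first exact: addr_ge0.
elim=> [|n IH] t /=.
  by rewrite integral_cst//= probability_setT mule1 lee_fin lerDl.
have mS := measurable_state n (t - 1).
rewrite (@integral_past_present R nu P iP _ _ t (state n (t - 1))
   (fun z => (lyap p lam (step z.1 z.2))%:E)) //; last 3 first.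
- by move=> w; apply: state_restrict; rewrite ltrBlDr ltrDl.
- by apply/measurable_EFinP; apply: measurable_lyap; exact: measurable_tarch_step.
- move=> w e; rewrite lee_fin; apply: (lyap_ge0 omega0 p (ltW lam0)).
  by apply: admissible_step => //; exact: state_admissible.
have l0 w : 0 <= lyap p lam (state n (t - 1) w).
  exact: (lyap_ge0 omega0 p (ltW lam0) (state_admissible _ _ _)).
have ml : measurable_fun setT (fun w => (lyap p lam (state n (t - 1) w))%:E).
  by apply/measurable_EFinP; exact: measurable_lyap.
apply: (@le_trans _ _ (\int[P]_w (rho%:E * (lyap p lam (state n (t - 1) w))%:E + C%:E))%E).
  apply: ge0_le_integral => //.
  - move=> w _; apply: integral_ge0 => e _; rewrite lee_fin.
    apply: (lyap_ge0 omega0 p (ltW lam0)).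
    by apply: admissible_step => //; exact: state_admissible.
  - apply: (@measurable_integral_present R nu _ _ _
      (fun z => (lyap p lam (step z.1 z.2))%:E)) => // [|w e].
      by apply/measurable_EFinP; apply: measurable_lyap; exact: measurable_tarch_step.
    rewrite lee_fin; apply: (lyap_ge0 omega0 p (ltW lam0)).
    by apply: admissible_step => //; exact: state_admissible.
  - by apply: emeasurable_funD => //; exact: measurable_funeM.
  - by move=> w _; rewrite -EFinM -EFinD; apply: drift; exact: state_admissible.
rewrite ge0_integralD//; last 2 first.
- by move=> w _; rewrite -EFinM lee_fin mulr_ge0.
- exact: measurable_funeM.
have -> : (\int[P]_w C%:E = C%:E)%E by rewrite integral_cst//= probability_setT mule1.
rewrite ge0_integralZl//; last by move=> w _; rewrite lee_fin.
apply: (@le_trans _ _ (rho%:E * K%:E + C%:E)%E).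
  by rewrite leeD2r// lee_wpmul2l// IH.
rewrite -EFinM -EFinD lee_fin.
have : (1 - rho) * (C / (1 - rho)) = C by rewrite mulrC divfK//; lra.
have : rho * lyap p lam (0, omega) <= lyap p lam (0, omega) by rewrite ler_piMl// ltW.
by rewrite /K; lra.
Qed.

End approximation.

(** * Almost sure coalescence of the approximations *)

Section coalescence.
Context {R : realType}.
Local Notation RT := (measurableTypeR R).
Local Notation space := (seqspace int RT).
Variables (omega alpha k : R) (p : nat) (nu : probability RT R) (P : probability space R).
Variables (lam K theta c2 c3 Y2 V2 r : R).
Local Notation st := (state omega alpha k).
Local Notation adm := (admissible omega alpha).
Local Notation W := (coupling_fun omega k p lam theta c2 c3 Y2 V2).
Hypothesis iP : iid_family P nu (fun t w => w t).
Hypotheses (omega0 : 0 < omega) (alpha0 : 0 <= alpha) (lam0 : 0 < lam).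
Hypotheses (theta0 : 0 <= theta) (r0 : 0 <= r) (r1 : r < 1) (K0 : 0 <= K).
Hypothesis lyapK : forall n t, (\int[P]_w (lyap p lam (st n t w))%:E <= K%:E)%E.
Hypothesis W_ge : forall z, adm z.1 -> adm z.2 -> (apart z)%:R / 4 <= W z.
Hypothesis W_le : forall z, adm z.1 -> adm z.2 ->
  W z <= 1 + theta * (lyap p lam z.1 + lyap p lam z.2).
Hypothesis W_contract : forall z, adm z.1 -> adm z.2 ->
  (\int[nu]_e (W (coupled_step omega alpha k z e))%:E <= (r * W z)%:E)%E.

(** Both components use the same last [n] innovations, so [Z n.+1 t] is one coupled step from
    [Z n (t - 1)]. It is the index [n] that plays the role of time. *)
Let Z n t (w : space) := (st n t w, st n.+1 t w).

Let measurable_Z n t : measurable_fun setT (Z n t).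
Proof. by apply: measurable_fun_pair; exact: measurable_state. Qed.

Let W_ge0 z : adm z.1 -> adm z.2 -> 0 <= W z.
Proof. by move=> a1 a2; apply: (le_trans _ (W_ge a1 a2)); rewrite divr_ge0. Qed.

Let adm_st n t w : adm (st n t w).
Proof. exact: state_admissible. Qed.

Let lyap_nonneg n t w : 0 <= lyap p lam (st n t w).
Proof. exact: (lyap_ge0 omega0 p (ltW lam0) (adm_st n t w)). Qed.

Let WZ_ge0 n t w : 0 <= W (Z n t w).
Proof. exact: (@W_ge0 (Z n t w) (adm_st n t w) (adm_st n.+1 t w)). Qed.

(** Each further common innovation costs a factor [r]; for [n = 0] the upper bound on [W] and the
    uniform Lyapunov bound give the constant. *)
Lemma coupling_decay n t :
  (\int[P]_w (W (Z n t w))%:E <= (r ^+ n * (1 + theta * (2 * K)))%:E)%E.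
Proof.
elim: n t => [|n IH] t.
  rewrite expr0 mul1r.
  have ml m : measurable_fun setT (fun w => (lyap p lam (st m t w))%:E).
    by apply/measurable_EFinP; apply: measurable_lyap; exact: measurable_state.
  apply: (@le_trans _ _ (\int[P]_w (1 + theta%:E * ((lyap p lam (st 0 t w))%:E +
      (lyap p lam (st 1 t w))%:E)))%E).
    apply: ge0_le_integral => //.
    - by move=> w _; rewrite lee_fin; exact: WZ_ge0.
    - by apply/measurable_EFinP; exact: measurable_coupling_fun.
    - by apply: emeasurable_funD => //; apply: measurable_funeM; exact: emeasurable_funD.
    - move=> w _; have := @W_le (Z 0 t w) (adm_st 0 t w) (adm_st 1 t w).
      by rewrite -lee_fin EFinD EFinM EFinD.
  rewrite ge0_integralD//; last 2 first.
  - by move=> w _; apply: mule_ge0 => //; apply: adde_ge0; rewrite lee_fin.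
  - by apply: measurable_funeM; exact: emeasurable_funD.
  rewrite [leRHS]EFinD. rewrite integral_cst//= probability_setT mule1 leeD2l//.
  have ms : measurable_fun setT (fun w => (lyap p lam (st 0 t w))%:E +
      (lyap p lam (st 1 t w))%:E)%E by exact: emeasurable_funD.
  have s0 w : setT w -> (0 <= (lyap p lam (st 0 t w))%:E +
      (lyap p lam (st 1 t w))%:E)%E by move=> _; apply: adde_ge0; rewrite lee_fin.
  rewrite ge0_integralZl// EFinM lee_wpmul2l// ge0_integralD//; last 2 first.
  - by move=> w _; rewrite lee_fin; exact: (lyap_nonneg 1 t w).
  - exact: (ml 1%N).
  apply: le_trans (leeD (lyapK 0 t) (lyapK 1 t)) _.
  by rewrite -EFinD lee_fin mulr2n mulrDl mul1r.
  by move=> w _; rewrite lee_fin; exact: (lyap_nonneg 0 t w).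
have h0 w e : (0 <= (W (coupled_step omega alpha k (Z n (t - 1) w) e))%:E)%E.
  rewrite lee_fin; exact: (@W_ge0 (coupled_step omega alpha k (Z n (t - 1) w) e)
    (admissible_step k omega0 alpha0 e (adm_st n (t - 1) w))
    (admissible_step k omega0 alpha0 e (adm_st n.+1 (t - 1) w))).
have mh : measurable_fun setT
    (fun x : ((R * R) * (R * R)) * RT => (W (coupled_step omega alpha k x.1 x.2))%:E).
  apply/measurable_EFinP; apply: measurable_coupling_fun.
  by apply: measurable_fun_pair => /=; apply: measurable_tarch_step => //;
    exact: measurableT_comp.
have -> : (\int[P]_w (W (Z n.+1 t w))%:E =
    \int[P]_w \int[nu]_e (W (coupled_step omega alpha k (Z n (t - 1) w) e))%:E)%E.
  apply: (@integral_past_present R nu P iP _ _ t (Z n (t - 1))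
    (fun x => (W (coupled_step omega alpha k x.1 x.2))%:E)) => // w.
  have tt : t - 1 < t by rewrite ltrBlDr ltrDl.
  by rewrite /Z !state_restrict.
have mW : measurable_fun setT (fun w => (W (Z n (t - 1) w))%:E).
  by apply/measurable_EFinP; exact: measurable_coupling_fun.
apply: (@le_trans _ _ (\int[P]_w (r%:E * (W (Z n (t - 1) w))%:E))%E).
  apply: ge0_le_integral => //.
  - by move=> w _; apply: integral_ge0 => e _; exact: h0.
  - exact: (@measurable_integral_present R nu _ _ (Z n (t - 1))
      (fun x => (W (coupled_step omega alpha k x.1 x.2))%:E)).
  - exact: measurable_funeM.
  - by move=> w _; rewrite -EFinM;
    exact: (@W_contract (Z n (t - 1) w) (adm_st n (t - 1) w) (adm_st n.+1 (t - 1) w)).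
rewrite ge0_integralZl//; last by move=> w _; rewrite lee_fin; exact: WZ_ge0.
by rewrite exprS -mulrA EFinM lee_wpmul2l// IH.
Qed.

(** The two approximations differ with probability at most four times the mean of [W], which is
    summable in [n]; Borel-Cantelli concludes. *)
Lemma state_coalesces t : {ae P, forall w, exists N, forall n, (N <= n)%N ->
  st n.+1 t w = st n t w}.
Proof.
pose F n : set space := [set w | apart (Z n t w)].
pose a : R := 4 * (1 + theta * (2 * K)).
have a0 : 0 <= a by rewrite mulr_ge0// addr_ge0// mulr_ge0// mulr_ge0.
(* [r] may vanish; [q] is a positive ratio between [r] and 1. *)
pose q : R := (r + 1) / 2.
have rr0 := r0; have rr1 := r1.
have q0 : 0 < q by rewrite /q; lra.
have q1 : q < 1 by rewrite /q; lra.
have rq : r <= q by rewrite /q; lra.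
have mapart n : measurable_fun setT (fun w => apart (Z n t w)).
  have mp (f : R * R -> R) m : measurable_fun setT f ->
      measurable_fun setT (fun w => f (st m t w)).
    by move=> mf; apply: measurableT_comp => //; exact: measurable_state.
  by apply: measurable_neg; apply: measurable_and; apply: measurable_fun_eqr; exact: mp.
have mF n : measurable (F n).
  rewrite (_ : F n = (fun w => apart (Z n t w)) @^-1` [set true]).
    by rewrite -[X in measurable X]setTI; exact: mapart.
  by apply/seteqP; split=> w.
have PF n : (P (F n) <= (a * q ^+ n)%:E)%E.
  have -> : P (F n) = (\int[P]_w ((apart (Z n t w))%:R)%:E)%E.
    rewrite -[in LHS](setIT (F n)) -integral_indic//.
    by apply: eq_integral => w _; rewrite indicE mem_setE.
  apply: (@le_trans _ _ (\int[P]_w (4%:E * (W (Z n t w))%:E))%E).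
    apply: ge0_le_integral => //.
    - apply/measurable_EFinP.
      exact: (measurableT_comp (f := fun b : bool => b%:R : R)).
    - by apply: measurable_funeM; apply/measurable_EFinP; exact: measurable_coupling_fun.
    - move=> w _; rewrite -EFinM lee_fin mulrC -ler_pdivrMr//.
      exact: (@W_ge (Z n t w) (adm_st n t w) (adm_st n.+1 t w)).
  rewrite ge0_integralZl//; last 2 first.
  - by apply/measurable_EFinP; exact: measurable_coupling_fun.
  - by move=> w _; rewrite lee_fin; exact: WZ_ge0.
  apply: (@le_trans _ _ (4%:E * (r ^+ n * (1 + theta * (2 * K)))%:E)%E).
    by rewrite lee_wpmul2l// coupling_decay.
  rewrite -EFinM lee_fin /a -mulrA ler_pM2l// mulrC ler_wpM2l//.
    by rewrite addr_ge0// mulr_ge0// mulr_ge0.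
  by rewrite lerXn2r ?nnegrE// ltW.
have sumF : (\sum_(n <oo) P (F n) < +oo)%E.
  apply: (@le_lt_trans _ _ (a / (1 - q))%:E); last exact: ltry.
  apply: lime_le; first exact: is_cvg_nneseries.
  apply: nearW => n; apply: (@le_trans _ _ (\sum_(0 <= i < n) (a * q ^+ i)%:E)%E).
    by apply: lee_sum => i _; exact: PF.
  rewrite sumEFin lee_fin; apply: geometric_le_lim => //.
  by rewrite gtr0_norm.
have mL : measurable (lim_sup_set F).
  apply: bigcapT_measurable => n; apply: bigcup_measurable => j _; exact: mF.
exists (lim_sup_set F); split => //; first exact: lim_sup_set_cvg0.
move=> w /= nex n _; apply: contrapT => nF; apply: nex.
exists n => m nm; apply/eqP; apply: contrapT => /negP neq; apply: nF.
exists m => //=; rewrite /F /= /apart /Z /=; apply: contraNN neq.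
by case: (st m t w) (st m.+1 t w) => [y v] [y' v'] /= /andP[/eqP-> /eqP->].
Qed.

End coalescence.

(** * Convergence, recursion and moments of the limit *)

Section volatility_theory.
Context {R : realType}.
Local Notation RT := (measurableTypeR R).
Local Notation space := (seqspace int RT).
Variables (omega alpha k : R) (p : nat) (nu : probability RT R) (P : probability space R).
Local Notation st := (state omega alpha k).
Local Notation V := (volatility omega alpha k).
Hypotheses (omega0 : 0 < omega) (alpha0 : 0 <= alpha).

Definition coalesces t (w : space) :=
  exists N, forall n, (N <= n)%N -> st n.+1 t w = st n t w.

Lemma coalescesE t w : coalesces t w ->
  exists N, forall n, (N <= n)%N -> (st n t w).2 = V t w.
Proof.
move=> [N hN]; exists N => n Nn.
have stN m : (N <= m)%N -> st m t w = st N t w.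
  move=> Nm; rewrite -(subnK Nm); elim: (m - N)%N => [//|i IH].
  by rewrite addSn hN// leq_addl.
rewrite stN//; apply/esym/volatilityE; apply: cvg_near_cst.
by exists N => // m /= Nm; rewrite stN.
Qed.

Lemma coalesces_cvg t w : coalesces t w ->
  (st n t w).2 @[n --> \oo] --> V t w.
Proof.
move=> /coalescesE[N hN]; apply: cvg_near_cst.
by exists N => // m /= Nm; rewrite hN.
Qed.

(** The indicator is discontinuous, so a plain limit would not do. At one large [n] all three
    approximations equal their limits and the finite recursion is the desired one. *)
Lemma coalesces_rec t w : coalesces t w -> coalesces (t - 1) w ->
  coalesces (t - 1 - 1) w ->
  V t w = omega + alpha * (V (t - 1) w * w t ^+ 2) *
    (k * (V (t - 1 - 1) w * w (t - 1) ^+ 2) < V (t - 1) w * w t ^+ 2)%R%:R.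
Proof.
move=> /coalescesE[N0 h0] /coalescesE[N1 h1] /coalescesE[N2 h2].
pose n := (N0 + N1 + N2)%N.
by rewrite -(h0 n.+2) /= -?(h1 n.+1)//= -?(h2 n)//; rewrite /n; lia.
Qed.

Lemma volatility_ge t w : (st n t w).2 @[n --> \oo] --> V t w -> omega <= V t w.
Proof.
move=> cV; apply: (cvgr_to_ge cV); apply: nearW => n.
by have [_] := state_admissible k omega0 alpha0 n t w.
Qed.

(** For [k = 0] the indicator vanishes only where the factor in front of it does. The recursion
    becomes continuous, so that convergence suffices in [rec0]. *)
Lemma state_rec0 n t w : k = 0 ->
  (st n.+1 t w).2 = omega + alpha * ((st n (t - 1) w).2 * w t ^+ 2).
Proof.
move=> -> /=; rewrite mul0r.
set y := _ * w t ^+ 2.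
have y0 : 0 <= y.
  rewrite mulr_ge0 ?sqr_ge0//.
  by have [_ h _] := state_admissible 0 omega0 alpha0 n (t - 1) w; exact: le_trans (ltW omega0) h.
have [->|y_neq0] := eqVneq y 0; first by rewrite mulr0 mul0r.
by rewrite lt0r y_neq0 y0 mulr1.
Qed.

Lemma rec0 t w : k = 0 -> (st n t w).2 @[n --> \oo] --> V t w ->
  (st n (t - 1) w).2 @[n --> \oo] --> V (t - 1) w ->
  V t w = omega + alpha * (V (t - 1) w * w t ^+ 2) *
    (k * (V (t - 1 - 1) w * w (t - 1) ^+ 2) < V (t - 1) w * w t ^+ 2)%R%:R.
Proof.
move=> kE c0 c1.
have V1 := volatility_ge c1.
have y0 : 0 <= V (t - 1) w * w t ^+ 2.
  by rewrite mulr_ge0 ?sqr_ge0//; exact: le_trans (ltW omega0) V1.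
transitivity (omega + alpha * (V (t - 1) w * w t ^+ 2)); last first.
  have -> : k * (V (t - 1 - 1) w * w (t - 1) ^+ 2) = 0 by rewrite kE mul0r.
  have [->|y_neq0] := eqVneq (V (t - 1) w * w t ^+ 2) 0; first by rewrite mulr0 mul0r.
  by rewrite lt0r y_neq0 y0 mulr1.
have c0' : (st n.+1 t w).2 @[n --> \oo] --> V t w.
  by move: c0; rewrite -(cvg_shiftS (fun n => (st n t w).2)).
apply/esym; apply: (cvg_unique _ _ c0') => //.
rewrite (_ : (fun n => _) =
    (fun n => omega + alpha * ((st n (t - 1) w).2 * w t ^+ 2))); last first.
  by apply/funext => n; exact: state_rec0.
apply: cvgD; first exact: cvg_cst.
by apply: cvgMl_tmp; exact: cvgMr_tmp.
Qed.

Lemma state_nondecreasing n t w : k = 0 -> (st n t w).2 <= (st n.+1 t w).2.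
Proof.
move=> kE; elim: n t => [|n IH] t.
  by have [_] := state_admissible k omega0 alpha0 1 t w.
rewrite (state_rec0 n t w kE) (state_rec0 n.+1 t w kE) lerD2l.
by apply: ler_wpM2l => //; apply: ler_wpM2r; [exact: sqr_ge0|exact: IH].
Qed.

Variables (lam K : R).
Hypotheses (lam0 : 0 < lam) (p1 : (1 <= p)%N).
Hypothesis lyapK : forall n t, (\int[P]_w (lyap p lam (st n t w))%:E <= K%:E)%E.

Lemma limn_einf_le (u : (\bar R)^nat) (x : \bar R) : (forall n, u n <= x)%E ->
  (limn_einf u <= x)%E.
Proof.
move=> ux; rewrite limn_einf_lim; apply: lime_le; first exact: is_cvg_einfs.
by apply: nearW => n; apply: le_trans (ux n); apply: ereal_inf_lbound; exists n => /=.
Qed.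

(** The approximations increase, so only finiteness of the limit is at stake. Since
    [v <= 1 + v ^+ p], the Lyapunov bound controls their means, and Fatou makes the limit
    integrable. *)
Lemma volatility_cvg0 t : k = 0 ->
  {ae P, forall w, (st n t w).2 @[n --> \oo] --> V t w}.
Proof.
move=> kE.
have ms n : measurable_fun setT (fun w => (st n t w).2%:E).
  by apply/measurable_EFinP; apply: measurableT_comp => //; exact: measurable_state.
have s0 n w : 0 <= (st n t w).2.
  by have [_ h _] := state_admissible k omega0 alpha0 n t w; exact: le_trans (ltW omega0) h.
pose L w := limn_einf (fun n => (st n t w).2%:E).
have L0 w : (0 <= L w)%E.
  rewrite /L limn_einf_lim; apply: lime_ge; first exact: is_cvg_einfs.
  by apply: nearW => n; apply: le_ereal_inf_tmp => _ [m _ <-]; rewrite lee_fin.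
have mL : measurable_fun setT L by exact: measurable_fun_limn_einf.
have intL : (\int[P]_w L w <= (1 + K / lam)%:E)%E.
  apply: le_trans (fatou P measurableT ms _) _; first by move=> n w _; rewrite lee_fin.
  apply: limn_einf_le => n.
  apply: (@le_trans _ _ (\int[P]_w (1 + (lam^-1)%:E * (lyap p lam (st n t w))%:E))%E).
    apply: ge0_le_integral => //.
    - by move=> w _; rewrite lee_fin.
    - apply: emeasurable_funD => //; apply: measurable_funeM; apply/measurable_EFinP.
      by apply: measurable_lyap; exact: measurable_state.
    - move=> w _; rewrite -EFinM -EFinD lee_fin /lyap mulrDr mulKf ?gt_eqF//.
      have [y0 _ _] := state_admissible k omega0 alpha0 n t w.
      have [x1|x1] := leP (st n t w).2 1.
        rewrite (le_trans x1)// lerDl addr_ge0 ?mulr_ge0 ?exprn_ge0 ?invr_ge0//.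
        exact: ltW.
      apply: (@le_trans _ _ ((st n t w).2 ^+ p)).
        by rewrite -[leLHS]expr1 ler_weXn2l// ltW.
      by rewrite addrA lerDr addr_ge0// mulr_ge0 ?exprn_ge0 ?invr_ge0 ?(ltW lam0).
  have l0 w : 0 <= lyap p lam (st n t w).
    exact: (lyap_ge0 omega0 p (ltW lam0) (state_admissible k omega0 alpha0 n t w)).
  have ml : measurable_fun setT (fun w => (lyap p lam (st n t w))%:E).
    by apply/measurable_EFinP; apply: measurable_lyap; exact: measurable_state.
  rewrite ge0_integralD//; last 2 first.
  - by move=> w _; rewrite -EFinM lee_fin mulr_ge0 ?invr_ge0 ?(ltW lam0).
  - exact: measurable_funeM.
  rewrite integral_cst//= probability_setT mule1 [leRHS]EFinD leeD2l//.
  rewrite ge0_integralZl// ?lee_fin ?invr_ge0 ?(ltW lam0)//; last first.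
    by move=> w _; rewrite lee_fin.
  by rewrite mulrC EFinM lee_wpmul2l ?lee_fin ?invr_ge0 ?(ltW lam0).
have iL : P.-integrable setT L.
  apply/integrableP; split => //; apply: le_lt_trans (ltry (1 + K / lam)).
  apply: le_trans intL; apply: ge0_le_integral => //.
  - exact: measurableT_comp.
  - by move=> w _; rewrite gee0_abs.
have := integrable_ae measurableT iL.
apply: filterS => w /(_ I) Lfin.
have nd : {homo (fun n => (st n t w).2) : n m / (n <= m)%N >-> n <= m}.
  by apply/nondecreasing_seqP => n; exact: state_nondecreasing.
have LE : L w = limn (fun n => (st n t w).2%:E).
  apply: is_cvg_limn_einfE; apply: ereal_nondecreasing_is_cvgn => n m nm.
  by rewrite lee_fin nd.
have bnd n : (st n t w).2 <= fine (L w).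
  rewrite -lee_fin fineK// LE; apply: lime_ge.
    apply: ereal_nondecreasing_is_cvgn => i j ij; rewrite lee_fin; exact: nd.
  by exists n => // m /= nm; rewrite lee_fin; exact: nd.
have cV : cvgn (fun n => (st n t w).2).
  apply: nondecreasing_is_cvgn => //.
  by exists (fine (L w)) => _ [n _ <-].
by rewrite (volatilityE cV).
Qed.

(** The integrand is almost surely the limit of the [p]-th powers of the first components of
    [st n.+1 t], each dominated by the Lyapunov function; Fatou carries the bound over. *)
Lemma innovation_moment t :
  {ae P, forall w, (st n (t - 1) w).2 @[n --> \oo] --> V (t - 1) w} ->
  (\int[P]_w ((Num.sqrt (V (t - 1) w) * w t) ^+ (2 * p))%:E <= K%:E)%E.
Proof.
move=> cV.
pose u n w := ((st n.+1 t w).1 ^+ p)%:E : \bar R.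
have mu n : measurable_fun setT (u n).
  apply/measurable_EFinP; apply: measurable_funX; apply: measurableT_comp => //.
  exact: measurable_state.
have u0 n w : (0 <= u n w)%E.
  by rewrite lee_fin exprn_ge0//; have [] := state_admissible k omega0 alpha0 n.+1 t w.
apply: (@le_trans _ _ (\int[P]_w limn_einf (u^~ w))%E).
  apply: ae_ge0_le_integral => //.
  - by move=> w _; rewrite lee_fin even_exp_ge0.
  - apply/measurable_EFinP; apply: measurable_funX; apply: measurable_funM.
      apply: (measurableT_comp (f := @Num.sqrt R)).
        by apply: continuous_measurable_fun; exact: sqrt_continuous.
      exact: measurable_volatility.
    exact: measurable_coord.
  - move=> w _; rewrite limn_einf_lim; apply: lime_ge; first exact: is_cvg_einfs.
    by apply: nearW => n; apply: le_ereal_inf_tmp => _ [m _ <-]; exact: u0.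
  - exact: measurable_fun_limn_einf.
  move: cV; apply: filterS => w cV _.
  have V0 := le_trans (ltW omega0) (volatility_ge cV).
  have sq : (Num.sqrt (V (t - 1) w) * w t) ^+ 2 = V (t - 1) w * w t ^+ 2.
    by rewrite exprMn sqr_sqrtr.
  rewrite exprM sq.
  have uV : u n w @[n --> \oo] --> ((V (t - 1) w * w t ^+ 2) ^+ p)%:E.
    apply/cvg_EFin; first exact: nearW.
    rewrite /comp /u /=.
    have cy : (st n (t - 1) w).2 * w t ^+ 2 @[n --> \oo] --> V (t - 1) w * w t ^+ 2.
      exact: cvgMr_tmp.
    elim: p => [|q IH]; first by under eq_fun do rewrite expr0; exact: cvg_cst.
    under eq_fun do rewrite exprS.
    by rewrite exprS; exact: cvgM cy IH.
  rewrite is_cvg_limn_einfE; last exact: cvgP uV.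
  by rewrite (cvg_lim _ uV).
apply: le_trans (fatou P measurableT mu _) _; first by move=> n w _; exact: u0.
apply: limn_einf_le => n; apply: le_trans (lyapK n.+1 t).
apply: ge0_le_integral => //.
- by apply/measurable_EFinP; apply: measurable_lyap; exact: measurable_state.
- move=> w _; rewrite lee_fin /lyap lerDl mulr_ge0 ?(ltW lam0)// exprn_ge0//.
  have [_ h _] := state_admissible k omega0 alpha0 n.+1 t w.
  exact: le_trans (ltW omega0) h.
Qed.

End volatility_theory.

(** * The stationary solution *)

Definition mkRV (R : realType) d (T : measurableType d) (P : probability T R)
    (X : T -> R) (mX : measurable_fun setT X) : {RV P >-> R} :=
  HB.pack X (isMeasurableFun.Build _ _ _ _ X mX).

Lemma square_density_events (R : realType) (nu : probability (measurableTypeR R) R)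
    (f : R -> R) :
  square_density nu f -> (forall y, 0 <= y -> 0 < f y) ->
  [/\ (0 < nu [set e | (1 <= e ^+ 2 <= 2)%R])%E,
      forall c : R, 0 < c -> (0 < nu [set e | (e ^+ 2 <= c)%R])%E &
      forall c : R, 0 <= c -> (0 < nu [set e | (c < e ^+ 2)%R])%E].
Proof.
move=> den f0; have pos := square_density_gt0 den f0; split=> [|c c0|c c0].
- have -> : [set e : R | 1 <= e ^+ 2 <= 2] = (fun x => x ^+ 2) @^-1` `[1, 2]%classic.
    by apply/seteqP; split=> e /=; rewrite in_itv.
  apply: pos => //; rewrite setIidl => [|y /=]; last first.
    by rewrite !in_itv/= andbT => /andP[y1 _]; exact: le_trans y1.
  by rewrite lebesgue_measure_itv/= lte_fin ltr1n -EFinB lte_fin subr_gt0 ltr1n.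
- have -> : [set e : R | e ^+ 2 <= c] = (fun x => x ^+ 2) @^-1` `[0, c]%classic.
    by apply/seteqP; split=> e /=; rewrite in_itv/= sqr_ge0.
  apply: pos => //; rewrite setIidl => [|y /=]; last first.
    by rewrite !in_itv/= andbT => /andP[].
  by rewrite lebesgue_measure_itv/= lte_fin c0 -EFinB lte_fin subr0.
- have -> : [set e : R | c < e ^+ 2] = (fun x => x ^+ 2) @^-1` `]c, +oo[%classic.
    by apply/seteqP; split=> e /=; rewrite in_itv/= andbT.
  apply: pos => //; rewrite setIidl => [|y /=]; last first.
    by rewrite !in_itv/= !andbT => cy; exact: le_trans c0 (ltW cy).
  by rewrite lebesgue_measure_itv/= ltry /= ?addye ?ltry.
Qed.

Theorem theorem3p3 (R : realType) (p : nat) (omega alpha k : R)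
    (nu : probability (measurableTypeR R) R) (f : R -> R) :
  (1 <= p)%N -> 0 < omega -> 0 <= alpha -> 0 <= k ->
  ('E_nu[fun x => x] = 0)%E -> ('E_nu[fun x => (x ^+ 2)%R] = 1)%E ->
  square_density nu f -> (forall y, 0 <= y -> 0 < f y) ->
  (moment nu p < +oo)%E ->
  (alpha%:E < moment_threshold nu p k)%E ->
  exists (d : measure_display) (T : measurableType d) (P : probability T R)
    (eta eps : int -> {RV P >-> R}),
    [/\ is_solution omega alpha k nu eta eps,
        strictly_stationary eps &
        forall t, ('E_P[fun w => (eps t w ^+ (2 * p))%R] < +oo)%E].
Proof.
move=> p1 om al k0 _ _ den f0 Mp thr.
have [s [Mps crit]] := threshold_witness p1 al k0 Mp thr.
have [lam [rho [C [lam0 /andP[rho0 rho1] C0 drift]]]] :=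
  lyap_drift om al k0 p1 Mp Mps crit.
have [P iP] := iid_exists nu.
have [K K0 lyapK] := state_lyap_bound iP om al lam0 rho0 rho1 C0 drift.
pose V := volatility omega alpha k.
have [cV rV] : (forall t, {ae P, forall w,
      (state omega alpha k n t w).2 @[n --> \oo] --> V t w}) /\
    (forall t, {ae P, forall w, V t w = omega + alpha * (V (t - 1) w * w t ^+ 2) *
      (k * (V (t - 1 - 1) w * w (t - 1) ^+ 2) < V (t - 1) w * w t ^+ 2)%R%:R}).
  have [kE|kN0] := eqVneq k 0.
    have c0 t := volatility_cvg0 om al lam0 p1 lyapK t kE.
    split=> // t; have := c0 (t - 1); have := c0 t.
    by apply: filterS2 => w; exact: rec0.
  have kgt0 : 0 < k by rewrite lt0r kN0.
  have [ev1 ev2 ev3] := square_density_events den f0.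
  have [theta [c2 [c3 [Y2 [V2 [r [theta0 /andP[r0 r1] Wge Wle Wc]]]]]]] :=
    coupling_contraction om al kgt0 p1 lam0 rho0 rho1 C0 drift ev1 ev2 ev3.
  have co t : {ae P, forall w, coalesces omega alpha k t w}.
    exact: (state_coalesces iP om al lam0 theta0 r0 r1 K0 lyapK Wge Wle Wc).
  split=> t; first by have := co t; apply: filterS => w; exact: coalesces_cvg.
  have := co (t - 1 - 1); have := co (t - 1); have := co t.
  by apply: filterS3 => w; exact: coalesces_rec.
pose T := seqspace int (measurableTypeR R).
have mV t : measurable_fun setT (V t : T -> R) by exact: measurable_volatility.
have meta t : measurable_fun setT (fun w : T => (w t : R)) by exact: measurable_coord.
(* The second component of the state at time [t] is the squared volatility of time [t + 1], whence
   the index [t - 1]. *)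
have msigma t : measurable_fun setT (fun w : T => Num.sqrt (V (t - 1) w)).
  apply: (measurableT_comp (f := @Num.sqrt R)) => //.
  by apply: continuous_measurable_fun; exact: sqrt_continuous.
have meps t : measurable_fun setT (fun w : T => Num.sqrt (V (t - 1) w) * w t).
  by apply: measurable_funM.
pose eta t := mkRV P (meta t); pose eps t := mkRV P (meps t).
exists _, T, P, eta, eps.
have etaE (t : int) (B : set R) : measurable B -> P (eta t @^-1` B) = nu B.
  by move=> mB; exact: (coord_law iP).
have eps_restrict t u w : t < u ->
    eps t (restrict_coords (fun s => s < u) w) = eps t w.
  move=> tu; rewrite /eps /mkRV /= /V volatility_restrict; last first.
    by apply: lt_trans tu; rewrite ltrBlDr ltrDl.
  by rewrite /restrict_coords tu.
split.
- split.
  + move=> sq B usq mB; rewrite (eq_bigr (fun i => nu (B i))); last first.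
      by move=> i _; exact: etaE.
    by rewrite -(iP _ _ usq mB).
  + by move=> t B mB; exact: etaE.
  + move=> t A B sA mB.
    (* The measurable sets fixed by restriction to the coordinates before [t] form a sigma-algebra
       containing every event of a single [eps u] with [u < t], hence the whole past of [eps]. *)
    have [mA rA] : measurable A /\ restrict_coords (fun s => s < t) @^-1` A = A.
      move: A sA; apply: smallest_sub.
        split => //=.
        * move=> A [mA rA]; rewrite setTD; split; first exact: measurableC.
          by rewrite -[in RHS]rA.
        * move=> F hF; split; first by apply: bigcup_measurable => i _; exact: (hF i).1.
          by rewrite preimage_bigcup; apply: eq_bigcupr => i _; exact: (hF i).2.
      move=> A [u /= ut [D mD <-]]; rewrite setTI; split.
        by rewrite -[X in measurable X]setTI; exact: (meps u).
      by apply/funext => w; exact: (congr1 D (eps_restrict _ _ w ut)).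
    exact: (indep_past_present iP mA mB rA).
  + exists (fun t => mkRV P (msigma t)) => t.
    have tE : t - 2 = t - 1 - 1 by rewrite -addrA -opprD.
    (* Almost surely the values under the roots are at least [omega], so squaring undoes the roots
       and [sigma] is positive. *)
    have geV : {ae P, forall w, [/\ omega <= V (t - 1) w, omega <= V (t - 1 - 1) w &
        omega <= V (t - 1 - 1 - 1) w]}.
      have := cV (t - 1 - 1 - 1); have := cV (t - 1 - 1); have := cV (t - 1).
      apply: filterS3 => w c1 c2 c3.
      by split; exact: volatility_ge.
    have := rV (t - 1); move: geV; apply: filterS2 => w [V1 V2' V3] rw.
    have sq (v e : R) : omega <= v -> (Num.sqrt v * e) ^+ 2 = v * e ^+ 2.
      by move=> ov; rewrite exprMn sqr_sqrtr// (le_trans (ltW om)).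
    split => //=.
    * rewrite tE !sq// sqr_sqrtr; last exact: le_trans (ltW om) V1.
      exact: rw.
    * by rewrite sqrtr_gt0 (lt_le_trans om).
- move=> n t h B mB.
  pose S := [set w : T | B [tuple eps (t i) w | i < n]].
  have mS : measurable S.
    have mt : measurable_fun setT
        (fun w : T => [tuple eps (t i) w | i < n] : n.-tuple (measurableTypeR R)).
      apply/measurable_fun_tnthP => i.
      rewrite (_ : _ \o _ = eps (t i)); first exact: (meps (t i)).
      by apply/funext => w; rewrite /= tnth_mktuple.
    by have := mt measurableT B mB; rewrite setTI.
  (* The process is a fixed function of the innovations seen from time [t], so the event at the
     translated times is the preimage of [S] under the shift. *)
  apply: etrans _ (shift_invariant iP h mS); congr (P _).
  have epsS w i : eps (t i) (shift h w) = eps (t i + h) w.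
    by rewrite /eps /mkRV /= /V volatility_shift addrAC.
  have tupS w : [tuple eps (t i) (shift h w) | i < n] =
      [tuple eps (t i + h) w | i < n].
    by apply: eq_from_tnth => i; rewrite !tnth_mktuple epsS.
  by apply/seteqP; split=> w; rewrite /S /= tupS.
- move=> t; rewrite unlock; apply: le_lt_trans (ltry K).
  exact: (innovation_moment om al lam0 lyapK (cV (t - 1))).
Qed.
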